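(* Let $\mathsf{k}$ be a field, $n\ge 1$, and let $\mathbf a,\mathbf b$ be two fan ordered vectors of $n$ positive integers, and let $\mathcal B=\mathcal B(\mathbf a,\mathbf b)=\mathsf{k}[Q]$. Let $h$ be the Hilbert number for $\mathcal B$. If $\mathfrak m$ is the ideal of $\mathcal B$ generated by the monomials $\neq 1$ with exponent vector in $Q$, then the Hilbert-Samuel multiplicity is $$\mathrm e(\mathfrak m,\mathcal B)=h-1 .$$ Furthermore, if the fan is non-degenerate, then $\mathrm e(\mathfrak m,\mathcal B)=|\mathcal H_0|+|\mathcal H_1|+\cdots+|\mathcal H_n|-n-1$.
   Context: $\mathbb N=\mathbb Z_{\ge 0}$. Let $R=\mathsf{k}[x_1,\dots,x_n]$, $I=(x_1^{a_1}\cdots x_n^{a_n})$, $J=(x_1^{b_1}\cdots x_n^{b_n})$. The intersection algebra is $\mathcal B(\mathbf a,\mathbf b)=\bigoplus_{r,s\in\mathbb N}(I^r\cap J^s)$, realized as the subring $\sum_{r,s}(I^r\cap J^s)u^rv^s$ of $R[u,v]$. It equals $\mathsf{k}[Q]$ with $Q=\{(r,s,t_1,\dots,t_n)\in\mathbb N^{n+2}: t_i\ge\max(a_ir,b_is),\ i=1,\dots,n\}$, where $(r,s,t_1,\dots,t_n)$ corresponds to $u^rv^sx_1^{t_1}\cdots x_n^{t_n}$; its dimension is $n+2$. Fan ordered means $a_i/b_i\ge a_{i+1}/b_{i+1}$ for $i=1,\dots,n-1$. Put $a_0=1,b_0=0,a_{n+1}=0,b_{n+1}=1$, with $1/0=\infty$.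 The fan is non-degenerate if $a_i/b_i>a_{i+1}/b_{i+1}$ for all $i=0,\dots,n$. For $i=0,\dots,n$ let $C_i=\{\lambda_1(b_i,a_i)+\lambda_2(b_{i+1},a_{i+1}):\lambda_1,\lambda_2\in\mathbb R_{\ge0}\}$, $Q_i=C_i\cap\mathbb N^2$, and let $\mathcal H_i$ be the Hilbert basis (unique minimal generating set) of the monoid $Q_i$. The Hilbert set is $\mathcal H=\bigcup_{i=0}^n\mathcal H_i$ and the Hilbert number is $h=|\mathcal H|$. *)

(* Defs.v *)
From Stdlib Require Import Rdefinitions Rseries.
From HB Require Import structures.
From mathcomp Require Import all_boot all_order all_algebra.
From mathcomp Require Import finmap mpoly.
From mathcomp Require Import boolp classical_sets constructive_ereal Rstruct.

Set Implicit Arguments.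
Unset Strict Implicit.
Unset Printing Implicit Defensive.

Import Order.TTheory GRing.Theory Num.Theory.
Local Open Scope classical_set_scope.
Local Open Scope ring_scope.

Section Ideals.
Variable A : comNzRingType.
Implicit Types (I J G : set A).

Definition is_ideal J : Prop :=
  [/\ J 0, forall x y, J x -> J y -> J (x + y) & forall c x, J x -> J (c * x)].

Definition ideal_gen G : set A := smallest is_ideal G.

(* For k = 0 the only generator is the empty product 1, so I^0 = A. *)
Definition ideal_pow I (k : nat) : set A :=
  ideal_gen [set x | exists2 f : 'I_k -> A,
                       (forall i, I (f i)) & x = \prod_(i < k) f i].

(* J <= c 0 < c 1 < ... < c l, all of them ideals *)
Definition ideal_chain J (l : nat) (c : nat -> set A) : Prop :=
  [/\ forall i, (i <= l)%N -> is_ideal (c i),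
      J `<=` c 0%N &
      forall i, (i < l)%N -> c i `<` c i.+1].

(* The A-module A / J has length l. Its submodules are the K / J for K an ideal
   containing J, so chains of submodules are chains of such ideals. *)
Definition quotient_has_length J (l : nat) : Prop :=
  (exists c, ideal_chain J l c) /\
  (forall l' c, ideal_chain J l' c -> (l' <= l)%N).

(* e(I, A) = lim_k d! * length(A / I^k) / k^d, for a ring A of dimension d; the
   lengths are required to be finite. *)
Definition hilbert_samuel_multiplicity (d : nat) I (e : R) : Prop :=
  exists ell : nat -> nat,
    (forall k, quotient_has_length (ideal_pow I k) (ell k)) /\
    Un_cv (fun k => (d`!%:R * (ell k)%:R / k%:R ^+ d)%R) e.

Lemma ideal_gen_ideal G : is_ideal (ideal_gen G).
Proof.
split=> [J [[]] //| x y Gx Gy J JG | c x Gx J JG].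
- by case: (JG) => -[_ JD _] _; apply: JD; [apply: Gx | apply: Gy].
- by case: (JG) => -[_ _ JM] _; apply: JM; apply: Gx.
Qed.

Lemma ideal_gen_sub G : G `<=` ideal_gen G.
Proof. by move=> x Gx J [_]; apply. Qed.

Lemma ideal_pow01 I : ideal_pow I 0 1.
Proof.
by apply: ideal_gen_sub; exists (fun=> 0) => [[]//|]; rewrite big_ord0.
Qed.

Lemma ideal_powM I r s x y :
  ideal_pow I r x -> ideal_pow I s y -> ideal_pow I (r + s) (x * y).
Proof.
have [P0 PD PM] := ideal_gen_ideal [set x | exists2 f : 'I_(r + s) -> A,
  (forall i, I (f i)) & x = \prod_(i < r + s) f i].
move=> xr ys; apply: (xr (fun x => ideal_pow I (r + s) (x * y))); split.
  split=> [|u v Pu Pv|c u Pu]; first by rewrite mul0r.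
  - by rewrite mulrDl; apply: PD.
  - by rewrite -mulrA; apply: PM.
move=> _ [f If ->]; apply: (ys (fun y => ideal_pow I (r + s) (_ * y))); split.
  split=> [|u v Pu Pv|c u Pu]; first by rewrite mulr0.
  - by rewrite mulrDr; apply: PD.
  - by rewrite mulrCA; apply: PM.
move=> _ [g Ig ->]; apply: ideal_gen_sub.
exists (fun i => match split i with inl j => f j | inr j => g j end).
  by move=> i; case: split.
rewrite big_split_ord /=; congr (_ * _); apply: eq_bigr => i _.
- by rewrite (unsplitK (inl i)).
- by rewrite (unsplitK (inr i)).
Qed.

End Ideals.

Section IntersectionAlgebra.
Variables (K : fieldType) (n : nat) (a b : n.-tuple nat).

(* R[u, v] with R = K[x_1, ..., x_n] *)
Notation Ruv := {mpoly {mpoly K[n]}[2]}.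

Definition monomial_ideal (c : n.-tuple nat) : set {mpoly K[n]} :=
  ideal_gen [set 'X_[Multinom c]].

(* Polynomials in u, v whose coefficient of u^r v^s lies in I^r \cap J^s. *)
Definition intersection_pred : {pred Ruv} := fun f =>
  `[< forall m : 'X_{1..2},
        (ideal_pow (monomial_ideal a) (m ord0) `&`
         ideal_pow (monomial_ideal b) (m ord_max)) f@_m >].

Fact intersection_subring_closed : subring_closed intersection_pred.
Proof.
have id c k : is_ideal (ideal_pow (monomial_ideal c) k) := ideal_gen_ideal _.
have subP c k x y : ideal_pow (monomial_ideal c) k x ->
    ideal_pow (monomial_ideal c) k y -> ideal_pow (monomial_ideal c) k (x - y).
  move=> cx cy; have [_ cD cM] := id c k.
  by apply: cD => //; rewrite -mulN1r; apply: cM.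
have sumP c k (I : Type) (s : seq I) (P : pred I) (F : I -> {mpoly K[n]}) :
    (forall i, P i -> ideal_pow (monomial_ideal c) k (F i)) ->
    ideal_pow (monomial_ideal c) k (\sum_(i <- s | P i) F i).
  by move=> cF; have [c0 cD _] := id c k; apply: big_ind.
split.
- apply/asboolP => m; rewrite mcoeff1; case: eqP => [->|_] /=.
    by rewrite !mnm0E; split; apply: ideal_pow01.
  by split; [have [] := id a (m ord0) | have [] := id b (m ord_max)].
- move=> f g /asboolP Hf /asboolP Hg; apply/asboolP => m; rewrite mcoeffB.
  by have [? ?] := Hf m; have [? ?] := Hg m; split; apply: subP.
- move=> f g /asboolP Hf /asboolP Hg; apply/asboolP => m; rewrite mcoeffM.
  have mE (p q : 'X_{1..2}) i : m == (p + q)%MM -> m i = (p i + q i)%N.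
    by move=> /eqP ->; rewrite mnmDE.
  split; apply: sumP => -[p q] /= pq; rewrite (mE _ _ _ pq); apply: ideal_powM;
    by [case: (Hf p) | case: (Hg q)].
Qed.

HB.instance Definition _ :=
  GRing.isSubringClosed.Build Ruv intersection_pred intersection_subring_closed.

Record intersection_algebra : predArgType := IntersectionAlgebra {
  ia_val :> Ruv;
  _ : ia_val \in intersection_pred
}.

HB.instance Definition _ := [isSub for ia_val].
HB.instance Definition _ := [Choice of intersection_algebra by <:].
HB.instance Definition _ :=
  [SubChoice_isSubComNzRing of intersection_algebra by <:].

(* The monoid Q; a point (r, s, t) has t : 'X_{1..n}. *)
Definition Qset : set (nat * nat * 'X_{1..n}) :=
  [set q : nat * nat * 'X_{1..n} | forall i : 'I_n,
     (maxn (tnth a i * q.1.1) (tnth b i * q.1.2) <= q.2 i)%N].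

(* u^r v^s x^t *)
Definition Qmonomial (q : nat * nat * 'X_{1..n}) : Ruv :=
  ('X_[q.2])%:MP * 'X_ord0 ^+ q.1.1 * 'X_ord_max ^+ q.1.2.

Definition max_ideal : set intersection_algebra :=
  ideal_gen [set f | exists q,
    [/\ Qset q, q <> (0%N, 0%N, 0%MM) & ia_val f = Qmonomial q]].

End IntersectionAlgebra.

Section Fan.
Variables (n : nat) (a b : n.-tuple nat).

(* The vectors extended by a_0 = 1, a_{n+1} = 0 and b_0 = 0, b_{n+1} = 1; the
   entries of a and b get the indices 1, ..., n. *)
Definition ext_a (i : nat) : nat := nth 0%N (1%N :: rcons a 0%N) i.
Definition ext_b (i : nat) : nat := nth 0%N (0%N :: rcons b 1%N) i.

(* a_i / b_i, with 1 / 0 = +oo *)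
Definition fan_slope (i : nat) : \bar rat :=
  if ext_b i == 0%N then +oo%E else ((ext_a i)%:R / (ext_b i)%:R)%:E.

Definition fan_ordered : Prop :=
  forall i, (0 < i < n)%N -> (fan_slope i.+1 <= fan_slope i)%O.

Definition fan_nondegenerate : Prop :=
  forall i, (i <= n)%N -> (fan_slope i.+1 < fan_slope i)%O.

Definition fan_cone (i : nat) : set (R * R) :=
  [set p | exists l1 l2 : R,
     [/\ 0 <= l1, 0 <= l2,
         p.1 = l1 * (ext_b i)%:R + l2 * (ext_b i.+1)%:R &
         p.2 = l1 * (ext_a i)%:R + l2 * (ext_a i.+1)%:R]].

Definition fan_monoid (i : nat) : set (nat * nat) :=
  [set p | fan_cone i (p.1%:R, p.2%:R)].

Definition generates (M G : set (nat * nat)) : Prop :=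
  M = [set p | exists2 s : seq (nat * nat),
                 (forall x, x \in s -> G x) & p = \sum_(x <- s) x].

(* H generates M and is contained in every generating set; there is at most one
   such H. *)
Definition is_hilbert_basis (M : set (nat * nat)) (H : {fset nat * nat}) : Prop :=
  generates M [set` H] /\ (forall G, generates M G -> [set` H] `<=` G).

Definition hilbert_basis (M : set (nat * nat)) : {fset nat * nat} :=
  xget fset0%fset [set H | is_hilbert_basis M H].

Definition fan_hilbert_basis (i : nat) : {fset nat * nat} :=
  hilbert_basis (fan_monoid i).

Definition hilbert_set : {fset nat * nat} :=
  \big[fsetU/fset0]_(i < n.+1) fan_hilbert_basis i.

Definition hilbert_number : nat := #|` hilbert_set|.

End Fan.

(* Main.v *)
Require Import Defs.
From Stdlib Require Import Rdefinitions Rseries SeqProp.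
From mathcomp Require Import all_boot all_order all_algebra.
From mathcomp Require Import finmap mpoly.
From mathcomp Require Import boolp classical_sets constructive_ereal Rstruct.
From mathcomp Require Import zify ring.

Set Implicit Arguments.
Unset Strict Implicit.
Unset Printing Implicit Defensive.

Import Order.TTheory GRing.Theory Num.Theory.
Local Open Scope ring_scope.

(** Why the multiplicity is h - 1.

    The monomials with exponent in Q are a basis of the algebra, and a power
    m^k of the maximal ideal is spanned by the monomials whose exponent is a
    sum of k nonzero elements of Q.  So the length of the quotient by m^k is
    the number of points of Q whose order, the largest number of nonzero
    summands, is less than k.  The order has a closed form.

    Sort the Hilbert set by angle: h_0 = (0, 1), h_1, ..., h_N = (1, 0), where
    N = h - 1.  Neighbours have determinant 1, so the h_j cut the quarter
    plane into N unimodular sectors.  Let [height] be the function that is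
    linear on each sector and equals 1 at every h_j, and let [ceiling] be the
    lower bound max(a_i r, b_i s) for the i-th exponent of x.  Then

      [adic_order] (p, t) = height p + sum_i (t_i - max(a_i r, b_i s)),  p = (r, s).

    A decomposition along the sector of p and along the coordinates of t
    shows that the left side is not smaller ([adic_order_split]).  That it is
    not larger says that height minus the sum of the ceilings is superadditive
    ([height_superadditive]), and this is a comparison of the bends of
    piecewise linear functions.  If h_{j-1} + h_{j+1} = c_j h_j, then the
    height bends by 2 - c_j across the ray of h_j.  The bend has the wrong
    sign only for c_j = 1; then h_j could be omitted from the chain, so it is
    there only because it is the direction of some (b_i, a_i), and across that
    ray the i-th ceiling bends by at least 1, which compensates.

    A point of Q of order less than k is thus a point p of a sector, given by
    two natural coordinates, and n natural numbers t_i - max(a_i r, b_i s),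
    with total sum less than k.  Each of the N sectors contributes a simplex
    of normalized volume 1 in dimension n + 2, and what the sectors share has
    smaller dimension.  Hence the limit is N.

    The chain h_0, ..., h_N is built first, from the Stern-Brocot tree and then
    by deleting superfluous rays ([indexed_fan_exists]).  It is the Hilbert
    set because on each fan monoid the ceilings are additive, so the height is
    superadditive there and its value 1 makes each h_j irreducible
    ([fan_hilbert_basisE]).  Consecutive fan monoids share exactly one h_j,
    so the sizes of the Hilbert bases add up to N + n + 1. *)

(** * Complete fans of unimodular cones in the quarter plane *)

(** The determinant that is nonnegative when [p] lies between [u] and the ray
    of (1, 0): as a function of [p] it vanishes on the ray of [u]. *)
Definition cross (u p : nat * nat) : int :=
  p.1%:Z * u.2%:Z - p.2%:Z * u.1%:Z.

Lemma pair_addE (p q : nat * nat) : p + q = ((p.1 + q.1)%N, (p.2 + q.2)%N).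
Proof. by []. Qed.

Lemma pair_mulrnE (p : nat * nat) m : p *+ m = ((p.1 * m)%N, (p.2 * m)%N).
Proof.
by elim: m => [|m IH]; rewrite ?mulr0n ?muln0 // mulrS IH pair_addE /= !mulnS.
Qed.

Lemma crossD u p q : cross u (p + q) = cross u p + cross u q.
Proof. by rewrite /cross pair_addE /= !PoszD; ring. Qed.

Lemma crossMn u p k : cross u (p *+ k) = cross u p *+ k.
Proof.
by elim: k => [|k IH];
  rewrite ?mulr0n ?mulrS ?crossD ?IH // /cross !mul0r subr0.
Qed.

Lemma crossDl u v p : cross (u + v) p = cross u p + cross v p.
Proof. by rewrite /cross pair_addE /= !PoszD; ring. Qed.

Lemma crossN u p : cross u p = - cross p u.
Proof. by rewrite /cross; ring. Qed.

Lemma cross_self u : cross u u = 0.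
Proof. by rewrite /cross; ring. Qed.

(** The linear relation between three vectors of the plane, paired with [p]. *)
Lemma cross_plucker u v w p :
  cross v w * cross u p + cross u v * cross w p = cross u w * cross v p.
Proof. by rewrite /cross; ring. Qed.

Definition unimodular : rel (nat * nat) := fun u v => cross u v == 1.

Definition unimodular_fan (s : seq (nat * nat)) : bool :=
  [&& head 0 s == (0, 1)%N, last 0 s == (1, 0)%N & sorted unimodular s].

Definition through (s T : seq (nat * nat)) : Prop :=
  forall t, t \in T -> exists2 u, u \in s & cross u t = 0.

Fixpoint stern_brocot k u v : seq (nat * nat) :=
  if k is k'.+1 then
    stern_brocot k' u (u + v) ++ (u + v) :: stern_brocot k' (u + v) v
  else [::].

(** Inserting the mediant [u + v] between neighbours of determinant 1 creates
    two pairs of neighbours of determinant 1. *)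
Lemma stern_brocot_path k u v : cross u v = 1 ->
  path unimodular u (rcons (stern_brocot k u v) v).
Proof.
elim: k u v => [|k IH] u v uv /=; first by rewrite /unimodular uv.
rewrite rcons_cat rcons_cons -cat_rcons cat_path last_rcons !IH //.
  by rewrite crossDl uv cross_self addr0.
by rewrite crossD uv cross_self add0r.
Qed.

(** Euclid's algorithm on the coordinates: to subtract the smaller one from
    the larger one is to pass to the half of the sector that contains the
    point, and equal coordinates are met on the mediant. *)
Lemma stern_brocot_through k u v x y : (0 < x)%N -> (0 < y)%N ->
    (x + y <= k.+1)%N ->
  exists2 w, w \in stern_brocot k u v & cross w (u *+ x + v *+ y) = 0.
Proof.
elim: k u v x y => [|k IH] u v x y x0 y0 xy; first by lia.
have [lt_xy|lt_yx|eq_xy] := ltngtP x y.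
- have [w ws w0] : exists2 w, w \in stern_brocot k (u + v) v &
      cross w ((u + v) *+ x + v *+ (y - x)) = 0 by apply: IH; lia.
  exists w; first by rewrite /= mem_cat in_cons ws !orbT.
  by rewrite -w0 mulrnDl -addrA -mulrnDr subnKC // ltnW.
- have [w ws w0] : exists2 w, w \in stern_brocot k u (u + v) &
      cross w (u *+ (x - y) + (u + v) *+ y) = 0 by apply: IH; lia.
  exists w; first by rewrite /= mem_cat ws.
  by rewrite -w0 mulrnDl addrA -mulrnDr subnK // ltnW.
- exists (u + v); first by rewrite /= mem_cat in_cons eqxx orbT.
  by rewrite eq_xy -mulrnDl crossMn cross_self mul0rn.
Qed.

Lemma unimodular_fan_exists (T : seq (nat * nat)) :
  (forall t, t \in T -> (0 < t.1)%N && (0 < t.2)%N) ->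
  exists2 s, unimodular_fan s & through s T.
Proof.
move=> T_pos; pose k := (\sum_(t <- T) (t.1 + t.2))%N.
exists ((0, 1)%N :: rcons (stern_brocot k (0, 1)%N (1, 0)%N) (1, 0)%N).
  by rewrite /unimodular_fan /= last_rcons !eqxx /= stern_brocot_path.
move=> t tT; have /andP[t1 t2] := T_pos t tT.
have [|w ws w0] := @stern_brocot_through k (0, 1)%N (1, 0)%N t.2 t.1 t2 t1.
  by rewrite ltnW // ltnS /k (big_rem t) //= addnC leq_addr.
exists w; first by rewrite in_cons mem_rcons in_cons ws !orbT.
by move: w0; rewrite !pair_mulrnE pair_addE /= !mul0n !mul1n addn0 -surjective_pairing.
Qed.

(** If [cross u w = 1] then [v = u + w], a ray that the sector of [u] and [w]
    can do without. *)
Lemma unimodular_fan_contract s1 u v w s2 :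
  unimodular_fan (s1 ++ [:: u, v, w & s2]) -> cross u w = 1 ->
  unimodular_fan (s1 ++ [:: u, w & s2]).
Proof.
move=> /and3P[hd lst srt] uw; apply/and3P; split.
- by case: s1 hd {lst srt}.
- by move: lst; rewrite !last_cat.
- case: s1 srt {hd lst} => [|x s1] /=; rewrite ?cat_path /=.
    by move=> /and3P[_ _ ->]; rewrite /unimodular uw eqxx.
  by move=> /and5P[-> -> _ _ ->]; rewrite /unimodular uw eqxx.
Qed.

(** Delete superfluous rays as long as some of them has no direction from [T]:
    a fan of minimal length cannot be contracted further. *)
Lemma reduced_fan_exists (T : seq (nat * nat)) :
  (forall t, t \in T -> (0 < t.1)%N && (0 < t.2)%N) ->
  exists s, [/\ unimodular_fan s, through s T &
    forall s1 u v w s2, s = s1 ++ [:: u, v, w & s2] -> cross u w = 1 ->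
      exists2 t, t \in T & cross v t = 0].
Proof.
move=> /unimodular_fan_exists[s].
move: {2}(size s) (leqnn (size s)) => m;
  elim: m s => [|m IH] s sz_s fan_s thr_s.
  by case: s sz_s fan_s thr_s.
have [?|] := pselect (forall s1 u v w s2,
  s = s1 ++ [:: u, v, w & s2] -> cross u w = 1 ->
      exists2 t, t \in T & cross v t = 0); first by exists s.
move=> /existsNP[s1] /existsNP[u] /existsNP[v] /existsNP[w] /existsNP[s2].
move=> /not_implyP[sE] /not_implyP[uw] nT.
apply: (IH (s1 ++ [:: u, w & s2])).
- by move: sz_s; rewrite sE !size_cat /=; lia.
- by apply: (@unimodular_fan_contract _ _ v) uw; rewrite -sE.
- move=> t tT; have [x xs x0] := thr_s t tT; exists x => //.
  move: xs; rewrite sE !mem_cat !in_cons => /or4P[->|->|/eqP xv|/orP[]->];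
    rewrite ?orbT //.
  by case: nT; exists t; rewrite // -xv.
Qed.

(** In a unimodular fan [h j.-1 + h j.+1] is the multiple of [h j] by
    [cross (h j.-1) (h j.+1)], so the last field says that a ray is superfluous
    only if it has a direction from [T]. *)
Record reduced_fan (T : seq (nat * nat)) (N : nat) (h : nat -> nat * nat) :
    Prop :=
  ReducedFan {
    fan_first : h 0%N = (0, 1)%N;
    fan_last : h N = (1, 0)%N;
    fan_unimodular : forall j, (j < N)%N -> cross (h j) (h j.+1) = 1;
    fan_through : forall t, t \in T ->
      exists2 j, (0 < j < N)%N & cross (h j) t = 0;
    fan_reduced : forall j, (0 < j < N)%N -> cross (h j.-1) (h j.+1) = 1 ->
      exists2 t, t \in T & cross (h j) t = 0
  }.

Lemma indexed_fan_exists (T : seq (nat * nat)) :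
  (forall t, t \in T -> (0 < t.1)%N && (0 < t.2)%N) ->
  exists N h, reduced_fan T N h.
Proof.
move=> T_pos; have [s [/and3P[/eqP hd /eqP lst srt] thr red]] :=
    reduced_fan_exists T_pos.
have s0 : nth 0 s 0 = (0, 1)%N by rewrite nth0; case: (s) hd.
have sN : nth 0 s (size s).-1 = (1, 0)%N by rewrite nth_last; case: (s) lst.
have s_gt0 : (0 < size s)%N by case: (s) hd.
exists (size s).-1, (nth 0 s); split=> //.
- by move=> j jN; apply/eqP; move/sortedP: srt; apply; lia.
- move=> t tT; have [u us u0] := thr t tT; have /andP[t1 t2] := T_pos t tT.
  exists (index u s); last by rewrite nth_index.
  have uE : nth 0 s (index u s) = u by rewrite nth_index.
  rewrite lt0n ltn_neqAle -ltnS prednK // index_mem us andbT.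
  apply/andP; split; apply: contraTneq t1 => jE; move: u0 t2;
    rewrite -uE jE ?s0 ?sN /cross;
    by case: (t) => x y /=; lia.
- case=> [//|j] /= jN; apply: (red (take j s) _ _ _ (drop j.+3 s)).
  have dropE i : (i < size s)%N -> drop i s = nth 0 s i :: drop i.+1 s :=
      @drop_nth _ 0 i s.
  by rewrite -!dropE ?cat_take_drop //; lia.
Qed.

Section ReducedFan.
Variables (T : seq (nat * nat)) (N : nat) (h : nat -> nat * nat).
Hypothesis T_pos : forall t, t \in T -> (0 < t.1)%N && (0 < t.2)%N.
Hypothesis fanP : reduced_fan T N h.

Lemma fan_nonempty : (0 < N)%N.
Proof. by case: N fanP => [[f0]|//]; rewrite f0. Qed.

(** Inside a quarter plane the angular order is transitive. *)
Lemma fan_increasing i j : (i < j <= N)%N -> 0 < cross (h i) (h j).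
Proof.
move=> /andP[]; elim: j => [//|j IH];
  rewrite ltnS leq_eqVlt => /orP[/eqP->|ij] jN.
  by rewrite (fan_unimodular fanP).
have := IH ij (ltnW jN); have := fan_unimodular fanP jN; rewrite /cross.
case: (h i) (h j) (h j.+1) => [u1 u2] [v1 v2] [w1 w2] /=.
move=> vw uv; have w1_gt0 : (0 < w1)%N by nia.
have u2_gt0 : (0 < u2)%N by nia.
have v1_gt0 : (0 < v1)%N by nia.
(* The relation between three vectors, with positive coefficients. *)
suff : 0 < (w1%:Z * u2%:Z - w2%:Z * u1%:Z) * v1%:Z by nia.
have -> : (w1%:Z * u2%:Z - w2%:Z * u1%:Z) * v1%:Z =
  w1%:Z * (v1%:Z * u2%:Z - v2%:Z * u1%:Z) +
  u1%:Z * (w1%:Z * v2%:Z - w2%:Z * v1%:Z) by ring.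
nia.
Qed.

Lemma fan_ge0 i j : (i <= j <= N)%N -> 0 <= cross (h i) (h j).
Proof.
move=> /andP[]; rewrite leq_eqVlt => /orP[/eqP->|ij jN];
  first by rewrite cross_self.
by rewrite ltW // fan_increasing // ij.
Qed.

Lemma fan_le0 i j : (j <= i <= N)%N -> cross (h i) (h j) <= 0.
Proof. by move=> ji; rewrite crossN oppr_le0 fan_ge0. Qed.

Lemma fan_inj i j : (i <= N)%N -> (j <= N)%N -> h i = h j -> i = j.
Proof.
move=> iN jN hij; have [ij|ji|//] := ltngtP i j.
  by have := @fan_increasing i j; rewrite ij jN hij cross_self => /(_ isT).
by have := @fan_increasing j i; rewrite ji iN hij cross_self => /(_ isT).
Qed.

Definition in_sector (j : nat) (p : nat * nat) (x y : nat) : Prop :=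
  (j < N)%N /\ p = h j *+ x + h j.+1 *+ y.

Lemma sector_cross_left j p x y : in_sector j p x y -> cross (h j) p = y%:Z.
Proof.
move=> [jN ->]; rewrite crossD !crossMn cross_self (fan_unimodular fanP) //.
by rewrite mul0rn add0r natz.
Qed.

Lemma sector_cross_right j p x y : in_sector j p x y ->
    cross (h j.+1) p = - x%:Z.
Proof.
move=> [jN ->]; rewrite crossD !crossMn cross_self mul0rn addr0.
by rewrite crossN (fan_unimodular fanP) // mulNrn natz.
Qed.

Lemma sector_cross_ge0 i j p x y : (i <= j)%N -> in_sector j p x y ->
    0 <= cross (h i) p.
Proof.
move=> ij [jN ->]; rewrite crossD !crossMn addr_ge0 // mulrn_wge0 // fan_ge0 //.
  by rewrite ij ltnW.
by rewrite jN andbT (leq_trans ij).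
Qed.

Lemma sector_cross_le0 i j p x y : (j < i <= N)%N -> in_sector j p x y ->
    cross (h i) p <= 0.
Proof.
move=> /andP[ji iN] [jN ->]; rewrite crossD !crossMn -oppr_ge0 opprD -!mulNrn.
by rewrite addr_ge0 // mulrn_wge0 // oppr_ge0 fan_le0 // iN ?andbT // ltnW.
Qed.

Lemma unimodular_coordinates u v p : cross u v = 1 ->
  p.1%:Z = cross u p * v.1%:Z - cross v p * u.1%:Z /\
  p.2%:Z = cross u p * v.2%:Z - cross v p * u.2%:Z.
Proof.
by move=> uv; split; rewrite -[LHS]mulr1 -uv /cross; ring.
Qed.

Lemma sectorI j p : (j < N)%N -> 0 <= cross (h j) p -> cross (h j.+1) p <= 0 ->
  in_sector j p `|cross (h j.+1) p|%N `|cross (h j) p|%N.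
Proof.
move=> jN uP vP; split=> //.
have [E1 E2] := unimodular_coordinates p (fan_unimodular fanP jN).
rewrite !pair_mulrnE pair_addE [LHS]surjective_pairing /=.
congr pair; apply/eqP; rewrite -eqz_nat PoszD !PoszM.
  by rewrite (lez0_abs vP) (gez0_abs uP) E1; apply/eqP; ring.
by rewrite (lez0_abs vP) (gez0_abs uP) E2; apply/eqP; ring.
Qed.

(** Apart from the ray of [h 0], the sectors are taken half-open, with the ray
    of [h j.+1] included, so that they are disjoint; hence the successor. *)
Lemma sector_cover p : (exists x, p = h 0%N *+ x) \/
  exists j x y, in_sector j p x y.+1.
Proof.
have [p1|p1] := posnP p.1.
  left; exists p.2; rewrite (fan_first fanP) pair_mulrnE /= mul0n mul1n -p1.
  by case: (p).
right; pose P j := (j <= N)%N && (0 < cross (h j) p).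
have P0 : exists j, P j.
  by exists 0%N; rewrite /P (fan_first fanP) /cross /= mulr1 mulr0 subr0.
have [j /andP[jN jp] j_max] := ex_maxnP P0 (fun j (Pj : P j) =>
    proj1 (andP Pj)).
have {}jN : (j < N)%N.
  rewrite ltn_neqAle jN andbT; apply: contraTneq jp => ->.
  by rewrite (fan_last fanP) /cross /= mulr1 mulr0 sub0r -leNgt oppr_le0.
have j1p : cross (h j.+1) p <= 0.
  by rewrite leNgt; apply/negP => j1p; have := j_max j.+1;
    rewrite /P jN j1p ltnn => /(_ isT).
have := sectorI jN (ltW jp) j1p; move: jp;
  case: (cross (h j) p) => [[|y]|] //= _.
by exists j, `|cross (h j.+1) p|%N, y.
Qed.

Lemma sector_unique j x y j' x' y' p :
  in_sector j p x y.+1 -> in_sector j' p x' y'.+1 ->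
  [/\ j = j', x = x' & y = y'].
Proof.
move=> S S'; have jj' : j = j'.
  have [jj'|j'j|//] := ltngtP j j'.
    have := sector_cross_le0 (i := j') _ S;
      rewrite jj' (ltnW (proj1 S')) => /(_ isT).
    by rewrite (sector_cross_left S').
  have := sector_cross_le0 (i := j) _ S';
    rewrite j'j (ltnW (proj1 S)) => /(_ isT).
  by rewrite (sector_cross_left S).
subst j'; split=> //.
  by have := sector_cross_right S;
    rewrite (sector_cross_right S') => /oppr_inj [].
by have := sector_cross_left S; rewrite (sector_cross_left S') => -[].
Qed.

Lemma sector_not_first j x y k : ~ in_sector j (h 0%N *+ k) x y.+1.
Proof.
move=> S; have := sector_cross_left S; rewrite crossMn => E.
have : cross (h j) (h 0%N) <= 0 by rewrite fan_le0 //= ltnW //; case: S.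
by move=> /(mulrn_wle0 k); rewrite E.
Qed.

(** Across the ray of [h j] the height gains this multiple of [cross (h j)]. *)
Definition bend j : int := 2 - cross (h j.-1) (h j.+1).

(** The function that is linear on every sector and equals 1 at every [h j],
    see [height_sector].  It is written as its linear part on the first sector
    and one correction for each inner ray, since each correction is
    superadditive up to a term of its own. *)
Definition height p : int := cross (h 0%N) p - cross (h 1%N) p +
  \sum_(1 <= j < N) bend j * Num.max 0 (cross (h j) p).

Lemma bend_le1 j : (0 < j < N)%N -> bend j <= 1.
Proof.
move=> /andP[j0 jN]; have : 0 < cross (h j.-1) (h j.+1).
  by rewrite fan_increasing // jN andbT; lia.
by rewrite /bend; lia.
Qed.

Lemma bend_cross j p : (0 < j < N)%N ->
  bend j * cross (h j) p =
  2 * cross (h j) p - cross (h j.-1) p - cross (h j.+1) p.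
Proof.
case: j => [//|j] /andP[_ jN] /=.
have := cross_plucker (h j) (h j.+1) (h j.+2) p.
rewrite (fan_unimodular fanP jN) (fan_unimodular fanP (ltnW jN)) => E.
by rewrite /bend /= mulrBl -E; ring.
Qed.

Lemma height_sector j p x y : in_sector j p x y -> height p = x%:Z + y%:Z.
Proof.
move=> S; have jN := proj1 S; rewrite /height (big_cat_nat (n := j.+1)) //=.
rewrite [X in _ + (_ + X)]big_nat [X in _ + (_ + X)]big1 ?addr0; last first.
  move=> i /andP[ji iN]; rewrite max_l ?mulr0 // (sector_cross_le0 _ S) //.
  by rewrite ji ltnW.
(* Adding the corrections of the rays 1, ..., i moves the linear part from
   the first sector to the i-th one. *)
have E i : (i <= j)%N -> cross (h 0%N) p - cross (h 1%N) p +
  \sum_(1 <= k < i.+1) bend k * Num.max 0 (cross (h k) p) =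
  cross (h i) p - cross (h i.+1) p.
  elim: i => [|i IH] ij; first by rewrite big_geq ?addr0.
  rewrite big_nat_recr //= addrA IH 1?ltnW //.
  rewrite max_r ?(sector_cross_ge0 ij S) //.
  by rewrite bend_cross ?(leq_ltn_trans ij) //=; ring.
by rewrite E // (sector_cross_left S) (sector_cross_right S); ring.
Qed.

Lemma height_first x : height (h 0%N *+ x) = x%:Z.
Proof.
by rewrite (@height_sector 0%N _ x 0) ?addr0 //; split;
  rewrite ?fan_nonempty ?mulr0n ?addr0.
Qed.

Lemma height_gt0 p : p != 0 -> 0 < height p.
Proof.
have [[x ->]|[j [x [y S]]]] := sector_cover p;
  last by rewrite (height_sector S); lia.
by rewrite height_first; case: x => //; rewrite mulr0n eqxx.
Qed.

Lemma height_fan j : (j <= N)%N -> height (h j) = 1.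
Proof.
case: j => [|j] jN; first by rewrite -[h 0%N]mulr1n height_first.
by rewrite (@height_sector j _ 0 1) //; split; rewrite // mulr0n add0r.
Qed.

(** For [t = (b, a)], the least exponent of x that may accompany u^r v^s in
    the intersection of the r-th and the s-th power. *)
Definition ceiling (t p : nat * nat) : nat := maxn (t.2 * p.1) (t.1 * p.2).

Definition defect t p q : int :=
    (ceiling t p)%:Z + (ceiling t q)%:Z - (ceiling t (p + q))%:Z.

Definition kink j p q : int :=
  Num.max 0 (cross (h j) p) + Num.max 0 (cross (h j) q) -
  Num.max 0 (cross (h j) (p + q)).

Lemma kink_ge0 j p q : 0 <= kink j p q.
Proof. by rewrite /kink crossD; lia. Qed.

Lemma ceilingE t p : (ceiling t p)%:Z = t.1%:Z * p.2%:Z + Num.max 0 (cross t p).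
Proof. by rewrite /ceiling /cross; lia. Qed.

Lemma defectE t p q : defect t p q =
   Num.max 0 (cross t p) + Num.max 0 (cross t q) - Num.max 0 (cross t (p + q)).
Proof. by rewrite /defect !ceilingE pair_addE PoszD /=; ring. Qed.

Lemma ray_multiple t j : t \in T -> (0 < j < N)%N -> cross (h j) t = 0 ->
  exists2 g : nat, (0 < g)%N & t = h j *+ g.
Proof.
move=> tT /andP[j0 jN] jt.
have /andP[t1 t2] := T_pos tT.
have E : (t.1%:Z = - cross (h j.+1) t * (h j).1%:Z).
  by have [-> _] := unimodular_coordinates t (fan_unimodular fanP jN);
    rewrite jt; ring.
have le0 : cross (h j.+1) t <= 0 by nia.
have [|_ tE] := sectorI jN _ le0; first by rewrite jt.
rewrite jt absz0 mulr0n addr0 in tE; exists `|cross (h j.+1) t|%N => //.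
by rewrite lt0n; apply: contraTneq t1 => g0; rewrite tE g0 mulr0n.
Qed.

Lemma cross_multiple u g p : cross (u *+ g) p = cross u p *+ g.
Proof. by rewrite crossN crossMn [in RHS]crossN mulNrn. Qed.

(** The ceiling of [t] is a linear function plus the positive part of
    [cross t], and [cross t] is a positive multiple of [cross (h j)]. *)
Lemma kink_le_defect t j p q : t \in T -> (0 < j < N)%N -> cross (h j) t = 0 ->
  kink j p q <= defect t p q.
Proof.
move=> tT j0N jt; have [g g0 tE] := ray_multiple tT j0N jt.
have E r : Num.max 0 (cross t r) = g%:Z * Num.max 0 (cross (h j) r).
  by rewrite tE cross_multiple -mulr_natl natz maxr_pMr // mulr0.
by rewrite defectE !E /kink; have := kink_ge0 j p q; rewrite /kink; nia.
Qed.

Lemma sum_mem_le (F : nat -> int) (l : seq nat) m n : (forall j, 0 <= F j) ->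
  \sum_(m <= j < n | j \in l) F j <= \sum_(j <- l) F j.
Proof.
move=> F0; elim: l => [|x l IH]; first by rewrite big_nil big1.
rewrite big_cons; apply: le_trans (lerD (lexx _) IH).
apply: (@le_trans _ _ (\sum_(m <= j < n | j == x) F j +
    \sum_(m <= j < n | j \in l) F j)).
  rewrite big_mkcond [in leRHS]big_mkcond [X in _ + X]big_mkcond -big_split /=.
  apply: ler_sum => j _; rewrite in_cons; have := F0 j.
  by case: (j == x) (j \in l) => -[] /=; rewrite ?addr0 ?add0r ?lerDl.
by rewrite lerD2r big_nat1_eq; case: ifP.
Qed.

(** The corrections with a coefficient at most 0 help.  A positive coefficient
    equals 1 and belongs to a superfluous ray, which has the direction of some
    [t] in [T]; the defect of [t] makes up for it, and different rays use
    different elements of [T]. *)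
Lemma height_superadditive p q :
  height p + height q <= height (p + q) + \sum_(t <- T) defect t p q.
Proof.
have -> : height p + height q = height (p + q) +
    \sum_(1 <= j < N) bend j * kink j p q.
  under eq_bigr do rewrite /kink mulrBr mulrDr.
  by rewrite sumrB big_split /= /height !crossD; ring.
rewrite lerD2l.
have [J JP] : exists J : nat * nat -> nat, forall t, t \in T ->
    (0 < J t < N)%N /\ cross (h (J t)) t = 0.
  have /choice[J JP] : forall t, exists j, t \in T ->
      (0 < j < N)%N /\ cross (h j) t = 0.
    move=> t; have [tT|tT] := boolP (t \in T); last by exists 0%N.
    by have [j ? ?] := fan_through fanP tT; exists j.
  by exists J.
apply: (@le_trans _ _ (\sum_(t <- T) kink (J t) p q)); last first.
  rewrite big_seq [leRHS]big_seq; apply: ler_sum => t tT.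
  by have [? ?] := JP t tT; apply: kink_le_defect.
apply: (@le_trans _ _ (\sum_(1 <= j < N | j \in map J T) kink j p q)).
  rewrite [leRHS]big_mkcond; apply: ler_sum_nat => j j0N.
  have b1 := bend_le1 j0N; have k0 := kink_ge0 j p q.
  case: ifPn => [_|jT]; first by nia.
  suff : bend j <= 0 by nia.
  have c0 : 0 < cross (h j.-1) (h j.+1).
    by apply: fan_increasing; case/andP: j0N => ? ?; lia.
  suff : cross (h j.-1) (h j.+1) != 1 by rewrite /bend; lia.
  apply: contra jT => /eqP /(fan_reduced fanP j0N)[t tT jt].
  apply/mapP; exists t => //; have [Jt0N Jt] := JP t tT.
  have [g g0 tE] := ray_multiple tT j0N jt; move: Jt.
  rewrite {2}tE crossMn => /eqP; rewrite mulrn_eq0 (gtn_eqF g0) /= => /eqP JJ.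
  move: Jt0N j0N => /andP[_ /ltnW JtN] /andP[_ /ltnW jN].
  have [lt|lt|//] := ltngtP (J t) j.
    by have := @fan_increasing (J t) j; rewrite lt jN JJ => /(_ isT).
  by have := @fan_increasing j (J t); rewrite lt JtN crossN JJ => /(_ isT).
apply: le_trans (sum_mem_le _ _ _ (fun j => kink_ge0 j p q)) _.
by rewrite big_map.
Qed.

Lemma height_superadditive_flat p q : (forall t, t \in T -> defect t p q = 0) ->
  height p + height q <= height (p + q).
Proof.
move=> flat; apply: le_trans (height_superadditive p q) _.
by rewrite big_seq big1 ?addr0.
Qed.

(** No ray of [T] meets the interior of a sector, so the ceilings are linear
    on sectors. *)
Lemma defect_sector j p q x y x' y' t : t \in T ->
  in_sector j p x y -> in_sector j q x' y' -> defect t p q = 0.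
Proof.
move=> tT S S'; have [i /andP[i0 iN] it] := fan_through fanP tT.
have [g g0 tE] := ray_multiple tT (introT andP (conj i0 iN)) it.
rewrite defectE tE !cross_multiple crossD.
have [ij|ji] := leqP i j.
  have := sector_cross_ge0 ij S; have := sector_cross_ge0 ij S' => le1 le2.
  have le3 := addr_ge0 le2 le1.
  move: (cross (h i) p) (cross (h i) q) le1 le2 le3 => cp cq le1 le2 le3.
  by rewrite !max_r ?mulrn_wge0 // mulrnDl subrr.
have iN' : (j < i <= N)%N by rewrite ji ltnW.
have := sector_cross_le0 iN' S; have := sector_cross_le0 iN' S' => le1 le2.
have le3 : cross (h i) p + cross (h i) q <= 0 by rewrite -[0]addr0 lerD.
move: (cross (h i) p) (cross (h i) q) le1 le2 le3 => cp cq le1 le2 le3.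
by rewrite !max_l ?mulrn_wle0 // addr0 subr0.
Qed.

End ReducedFan.

(** * Hilbert bases of the fan monoids *)

Definition irreducible_in (M : set (nat * nat)) (p : nat * nat) : Prop :=
  [/\ M p, p != 0 & forall q r, M q -> M r -> p = q + r -> q = 0 \/ r = 0].

(** An irreducible element is a sum of elements of a generating set only if it
    belongs to that set. *)
Lemma is_hilbert_basis_irreducible
    (M : set (nat * nat)) (H : {fset nat * nat}) :
  M 0 -> (forall p q, M p -> M q -> M (p + q)) ->
  (forall p, p \in H -> irreducible_in M p) ->
  (forall p, M p -> exists2 s : seq (nat * nat),
     (forall x, x \in s -> x \in H) & p = \sum_(x <- s) x) ->
  is_hilbert_basis M H.
Proof.
move=> M0 MD irr gen.
have sumM (s : seq (nat * nat)) : (forall x, x \in s -> M x) ->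
    M (\sum_(x <- s) x).
  by move=> sM; rewrite big_seq; apply: (big_ind M).
split.
  apply/seteqP; split=> [p /gen //|p [s sH ->]] /=.
  by apply: sumM => x /sH /irr[].
move=> G genG p /= /irr[Mp p0 p_irr].
have GM x : G x -> M x.
  by move=> Gx; rewrite genG; exists [:: x] => [y|];
    rewrite ?big_seq1 // inE => /eqP->.
move: Mp; rewrite {1}genG => -[s sG]; elim: s sG => [|x s IH] sG pE.
  by rewrite big_nil in pE; rewrite pE eqxx in p0.
have Gx : G x by apply: sG; rewrite mem_head.
have sG' y : y \in s -> G y by move=> ys; apply: sG; rewrite in_cons ys orbT.
move: pE; rewrite big_cons => pE.
have [||x0|s0] := p_irr _ _ _ _ pE; first exact: GM.
- by apply: sumM => y /sG' /GM.
- by apply: IH => //; rewrite pE x0 add0r.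
- by rewrite pE s0 addr0.
Qed.

Lemma hilbert_basisE M H : is_hilbert_basis M H -> hilbert_basis M = H.
Proof.
move=> HH; apply: xget_unique => // H' [gen' min']; have [gen min] := HH.
apply/fsetP => x; apply/idP/idP; first exact: (min' _ gen x).
exact: (min _ gen' x).
Qed.

(** Cramer's rule.  The second case is that of two vectors on one ray, when
    both inequalities force [p] onto that ray. *)
Lemma real_coneP (u v p : nat * nat) :
  0 < cross u v \/
  (cross u v = 0 /\ (0 < u.1)%N /\ (0 < u.2)%N /\ (0 < v.1)%N) ->
  (exists l1 l2 : R, [/\ 0 <= l1, 0 <= l2,
     p.1%:R = l1 * u.1%:R + l2 * v.1%:R &
     p.2%:R = l1 * u.2%:R + l2 * v.2%:R]) <->
  (0 <= cross u p) && (cross v p <= 0).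
Proof.
move=> uv; have crossR w q :
    (cross w q)%:~R = q.1%:R * w.2%:R - q.2%:R * w.1%:R :> R.
  by rewrite /cross rmorphB !rmorphM.
have uv0 : 0 <= cross u v by case: uv => [/ltW //|[-> _]].
split=> [[l1 [l2 [l1_ge0 l2_ge0 E1 E2]]]|/andP[up vp]].
  apply/andP; split.
    rewrite -(ler0z R) crossR E1 E2.
    have -> : (l1 * u.1%:R + l2 * v.1%:R) * u.2%:R -
      (l1 * u.2%:R + l2 * v.2%:R) * u.1%:R = l2 * (cross u v)%:~R by rewrite crossR; ring.
    by rewrite mulr_ge0 // ler0z.
  rewrite -(lerz0 R) crossR E1 E2.
  have -> : (l1 * u.1%:R + l2 * v.1%:R) * v.2%:R -
    (l1 * u.2%:R + l2 * v.2%:R) * v.1%:R = - (l1 * (cross u v)%:~R) by rewrite crossR; ring.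
  by rewrite oppr_le0 mulr_ge0 // ler0z.
case: uv => [uv|[uv [u1 [u2 v1]]]].
  have d0 : (cross u v)%:~R != 0 :> R by rewrite intr_eq0 gt_eqF.
  exists (- (cross v p)%:~R / (cross u v)%:~R),
      ((cross u p)%:~R / (cross u v)%:~R).
  split.
  - by rewrite divr_ge0 ?ler0z // oppr_ge0 lerz0.
  - by rewrite divr_ge0 ?ler0z.
  - by move: d0; rewrite !crossR => d0; field.
  - by move: d0; rewrite !crossR => d0; field.
have up0 : cross u p = 0.
  have : cross u p * v.1%:Z = u.1%:Z * cross v p.
    transitivity (p.1%:Z * cross u v + u.1%:Z * cross v p);
      last by rewrite uv mulr0 add0r.
    by rewrite /cross; ring.
  nia.
have u1R : u.1%:R != 0 :> R by rewrite pnatr_eq0 -lt0n.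
exists (p.1%:R / u.1%:R), 0; rewrite !mul0r !addr0 divfK //; split=> //;
  first by rewrite divr_ge0.
apply: (mulIf u1R); rewrite mulrAC divfK //.
by apply/eqP; rewrite -subr_eq0 -opprB oppr_eq0 -crossR up0.
Qed.

Lemma in_fset_seq (s : seq (nat * nat)) x :
    (x \in [fset y in s]%fset) = (x \in s).
Proof. by rewrite in_fset. Qed.

Section FanMonoids.
Variables (n : nat) (a b : n.-tuple nat).
Hypothesis n_gt0 : (0 < n)%N.
Hypothesis a_gt0 : forall i : 'I_n, (0 < tnth a i)%N.
Hypothesis b_gt0 : forall i : 'I_n, (0 < tnth b i)%N.
Hypothesis ab_fan : fan_ordered a b.

(** The vectors (b_i, a_i) that bound the cones of the fan. *)
Definition ray i : nat * nat := (ext_b b i, ext_a a i).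

Definition slope_rays : seq (nat * nat) :=
  [seq (tnth b i, tnth a i) | i : 'I_n].

Lemma ray0 : ray 0 = (0, 1)%N.
Proof. by []. Qed.

Lemma ray_last : ray n.+1 = (1, 0)%N.
Proof. by rewrite /ray /ext_a /ext_b /= !nth_rcons !size_tuple ltnn eqxx. Qed.

Lemma ray_tnth (i : 'I_n) : ray i.+1 = (tnth b i, tnth a i).
Proof.
by rewrite /ray /ext_a /ext_b /= !nth_rcons !size_tuple ltn_ord !(tnth_nth 0%N).
Qed.

Lemma ray_in_slope_rays i : (0 < i <= n)%N -> ray i \in slope_rays.
Proof.
case: i => [//|i] /= i_lt_n; apply/mapP; exists (Ordinal i_lt_n);
  first by rewrite mem_enum.
exact: (ray_tnth (Ordinal i_lt_n)).
Qed.

Lemma slope_rays_pos t : t \in slope_rays -> (0 < t.1)%N && (0 < t.2)%N.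
Proof. by move=> /mapP[i _ ->]; rewrite a_gt0 b_gt0. Qed.

Lemma ray_pos i : (0 < i <= n)%N -> (0 < (ray i).1)%N && (0 < (ray i).2)%N.
Proof. by move=> /ray_in_slope_rays/slope_rays_pos. Qed.

(** The slopes decrease, so the rays are ordered by angle. *)
Lemma cross_ray_inner i : (0 < i < n)%N -> 0 <= cross (ray i) (ray i.+1).
Proof.
move=> i0n; have /andP[i0 iN] := i0n.
have /andP[bi ai] : (0 < (ray i).1)%N && (0 < (ray i).2)%N
    by rewrite ray_pos // i0 ltnW.
have /andP[bi1 ai1] : (0 < (ray i.+1).1)%N && (0 < (ray i.+1).2)%N
    by rewrite ray_pos.
have := ab_fan i0n; rewrite /fan_slope !gtn_eqF // lee_fin.
rewrite ler_pdivrMr ?ltr0n // mulrAC ler_pdivlMr ?ltr0n //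
    -!natrM ler_nat /cross /=.
by rewrite subr_ge0 -!PoszM lez_nat [(ext_b b i.+1 * _)%N]mulnC.
Qed.

Lemma cross_ray i : (i <= n)%N -> 0 <= cross (ray i) (ray i.+1).
Proof.
move=> i_le_n; have [->|i0] := posnP i;
  first by rewrite ray0 /cross /= mulr0 subr0 mulr1.
have [i_lt_n|n_le_i] := ltnP i n; first by rewrite cross_ray_inner ?i0.
have -> : i = n by apply/eqP; rewrite eqn_leq i_le_n.
by rewrite ray_last /cross /= mul0r subr0 mul1r.
Qed.

Lemma fan_monoidE i p : (i <= n)%N ->
  fan_monoid a b i p <-> (0 <= cross (ray i) p) && (cross (ray i.+1) p <= 0).
Proof.
move=> i_le_n; apply: (@real_coneP (ray i) (ray i.+1)).
have [->|i0] := posnP i.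
  left; rewrite ray0; have /andP[b1 _] := @ray_pos 1 n_gt0.
  by rewrite /cross mulr1 mulr0 subr0 ltz_nat.
have /andP[bi ai] : (0 < (ray i).1)%N && (0 < (ray i).2)%N
    by rewrite ray_pos // i0.
have [i_lt_n|n_le_i] := ltnP i n; last first.
  have iE : i = n by apply/eqP; rewrite eqn_leq i_le_n.
  by left; rewrite {2}iE ray_last /cross mul1r mul0r subr0 ltz_nat.
have := cross_ray i_le_n; rewrite le_eqVlt => /orP[/eqP E|]; last by left.
by right; split=> //; have /andP[] := @ray_pos i.+1 i_lt_n.
Qed.

(** Take the last ray that does not come after [p]. *)
Lemma fan_monoid_cover p : exists2 i, (i <= n)%N & fan_monoid a b i p.
Proof.
pose P i := (i <= n)%N && (0 <= cross (ray i) p).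
have P0 : exists i, P i by exists 0%N; rewrite /P ray0 /cross mulr1 mulr0 subr0.
have [i /andP[i_le_n ip] i_max] := ex_maxnP P0 (fun i (Pi : P i) =>
    proj1 (andP Pi)).
exists i => //; apply/fan_monoidE => //; rewrite ip /=.
have [i_lt_n|n_le_i] := ltnP i n; last first.
  have -> : i = n by apply/eqP; rewrite eqn_leq i_le_n.
  by rewrite ray_last /cross mulr0 mulr1 sub0r oppr_le0.
rewrite leNgt; apply/negP => /ltW i1p.
by have := i_max i.+1; rewrite /P i_lt_n i1p ltnn => /(_ isT).
Qed.

Variables (N : nat) (h : nat -> nat * nat).
Hypothesis fanP : reduced_fan slope_rays N h.

Let hge0 := fan_ge0 fanP.
Let hle0 := fan_le0 fanP.
Let hincr := fan_increasing fanP.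

(** Each boundary ray of a cone is a multiple of a unique ray of the reduced
    fan; the order of the slopes makes the index monotone. *)
Lemma ray_index : exists J : nat -> nat, [/\ J 0%N = 0%N, J n.+1 = N,
  forall i, (i <= n)%N -> (J i <= J i.+1)%N &
  forall i, (i <= n.+1)%N -> (J i <= N)%N /\
     exists2 g, (0 < g)%N & ray i = h (J i) *+ g].
Proof.
have /choice[J JP] : forall i, exists j, (i <= n.+1)%N -> (j <= N)%N /\
     exists2 g, (0 < g)%N & ray i = h j *+ g.
  move=> i; have [->|i0] := posnP i.
    by exists 0%N => _; split=> //; exists 1%N;
      rewrite // mulr1n (fan_first fanP).
  have [->|i_neq] := eqVneq i n.+1.
    by exists N => _; split=> //; exists 1%N;
      rewrite // mulr1n (fan_last fanP) ray_last.
  have [i_le_n|] := boolP (0 < i <= n)%N; last first.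
    by exists 0%N; lia.
  have iT := ray_in_slope_rays i_le_n; have [j jN ji] := fan_through fanP iT.
  exists j => _; split; first by case/andP: jN => _ /ltnW.
  exact: ray_multiple slope_rays_pos fanP _ _ iT jN ji.
exists J.
have J0 : J 0%N = 0%N.
  have [J0N [g g0 E]] := JP 0%N isT; apply/eqP; rewrite eqn0Ngt;
    apply/negP => J0.
  have := hincr (introT andP (conj J0 J0N)); rewrite (fan_first fanP).
  have : (h (J 0%N)).1 = 0%N.
    by move: E; rewrite ray0 pair_mulrnE => -[/eqP];
      rewrite eq_sym muln_eq0 (gtn_eqF g0) orbF => /eqP.
  by rewrite /cross => -> /=; rewrite mulr0 subr0 mul0r ltxx.
have JN : J n.+1 = N.
  have [JnN [g g0 E]] := JP n.+1 (leqnn _); apply/eqP;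
    rewrite eqn_leq JnN leqNgt; apply/negP => Jn.
  have := hincr (introT andP (conj Jn (leqnn _))); rewrite (fan_last fanP).
  have : (h (J n.+1)).2 = 0%N.
    by move: E; rewrite ray_last pair_mulrnE => -[_ /eqP];
      rewrite eq_sym muln_eq0 (gtn_eqF g0) orbF => /eqP.
  by rewrite /cross => -> /=; rewrite mul0r subr0 mulr0 ltxx.
split=> // i i_le_n; have := cross_ray i_le_n.
have [JiN [g g0 ->]] := JP i (leqW i_le_n).
have [Ji1N [g' g'0 ->]] := JP i.+1 i_le_n.
rewrite cross_multiple crossMn leqNgt => c_ge0; apply/negP => Ji.
have c_lt0 : cross (h (J i)) (h (J i.+1)) < 0.
  by rewrite crossN oppr_lt0 hincr // Ji.
by move: c_ge0; rewrite -mulrnA pmulrn_lge0 ?muln_gt0 ?g0 ?g'0 // leNgt c_lt0.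
Qed.

Lemma cross_transfer u w p :
  cross u p * w.1%:Z = p.1%:Z * cross u w + u.1%:Z * cross w p /\
  cross u p * w.2%:Z = p.2%:Z * cross u w + u.2%:Z * cross w p.
Proof. by split; rewrite /cross; ring. Qed.

Lemma cross_ge0_before k k' p : (k <= k' <= N)%N ->
  0 <= cross (h k') p -> 0 <= cross (h k) p.
Proof.
move=> /andP[kk' k'N] k'p; have [->//|k_neq] := eqVneq k k'.
have k_lt : (0 < k')%N by lia.
have w1 : 0 < (h k').1%:Z.
  have := @hincr 0%N k'; rewrite k_lt k'N => /(_ isT).
  by rewrite (fan_first fanP) /cross /= mulr1 mulr0 subr0.
rewrite -(pmulr_lge0 _ w1); have [-> _] := cross_transfer (h k) (h k') p.
by rewrite addr_ge0 ?mulr_ge0 // hge0 // kk'.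
Qed.

Lemma cross_le0_after k k' p : (k <= k' <= N)%N ->
  cross (h k) p <= 0 -> cross (h k') p <= 0.
Proof.
move=> /andP[kk' k'N] kp; have [<-//|k_neq] := eqVneq k k'.
have k_lt : (k < N)%N by lia.
have w2 : 0 < (h k).2%:Z.
  have := @hincr k N; rewrite k_lt leqnn => /(_ isT).
  by rewrite (fan_last fanP) /cross /= mul1r mul0r subr0.
rewrite -(pmulr_lle0 _ w2); have [_ ->] := cross_transfer (h k') (h k) p.
by rewrite -[0]addr0 lerD // mulr_ge0_le0 // hle0 // kk'.
Qed.

Variable J : nat -> nat.
Hypothesis J0 : J 0%N = 0%N.
Hypothesis Jlast : J n.+1 = N.
Hypothesis J_mono : forall i, (i <= n)%N -> (J i <= J i.+1)%N.
Hypothesis J_ray : forall i, (i <= n.+1)%N -> (J i <= N)%N /\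
     exists2 g, (0 < g)%N & ray i = h (J i) *+ g.

Lemma J_homo i i' : (i <= i' <= n.+1)%N -> (J i <= J i')%N.
Proof.
move=> /andP[]; elim: i' => [|i' IH]; first by rewrite leqn0 => /eqP->.
rewrite leq_eqVlt => /orP[/eqP->//|ii'] i'n.
by apply: leq_trans (J_mono _); rewrite ?IH // ltnW.
Qed.

Lemma fan_monoid_sectors i p : (i <= n)%N ->
  fan_monoid a b i p <-> (0 <= cross (h (J i)) p) && (cross (h (J i.+1)) p <= 0).
Proof.
move=> i_le_n; rewrite fan_monoidE //.
have [_ [g g0 ->]] := J_ray (leqW i_le_n).
have [_ [g' g'0 ->]] := @J_ray i.+1 i_le_n.
by rewrite !cross_multiple pmulrn_lge0 // pmulrn_lle0.
Qed.

Lemma fan_monoid0 i : (i <= n)%N -> fan_monoid a b i 0.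
Proof.
by move=> i_le_n; apply/fan_monoid_sectors; rewrite // /cross !mul0r subrr.
Qed.

Lemma fan_monoidD i p q : (i <= n)%N ->
  fan_monoid a b i p -> fan_monoid a b i q -> fan_monoid a b i (p + q).
Proof.
move=> i_le_n /(fan_monoid_sectors _ i_le_n)/andP[p1 p2].
move=> /(fan_monoid_sectors _ i_le_n)/andP[q1 q2].
apply/fan_monoid_sectors => //; rewrite !crossD.
by apply/andP; split; [rewrite addr_ge0 | rewrite -[0]addr0 lerD].
Qed.

Lemma fan_monoid_h i j : (i <= n)%N -> (j <= N)%N ->
  fan_monoid a b i (h j) <-> (J i <= j <= J i.+1)%N.
Proof.
move=> i_le_n jN; rewrite fan_monoid_sectors //.
have [JiN _] := J_ray (leqW i_le_n); have [Ji1N _] := @J_ray i.+1 i_le_n.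
split=> /andP[ij ji]; last by rewrite hge0 ?ij // hle0 ?ji.
apply/andP; split; rewrite leqNgt; apply/negP => lt.
  by move: ij; rewrite crossN oppr_ge0 leNgt hincr // lt.
by move: ji; rewrite leNgt hincr // lt.
Qed.

(** On a cone of the fan each ceiling is one of its two linear pieces: the
    pieces change only on a boundary ray. *)
Lemma fan_monoid_flat i p q t : (i <= n)%N ->
  fan_monoid a b i p -> fan_monoid a b i q -> t \in slope_rays ->
  defect t p q = 0.
Proof.
move=> i_le_n /(fan_monoid_sectors _ i_le_n)/andP[p1 p2].
move=> /(fan_monoid_sectors _ i_le_n)/andP[q1 q2] /mapP[l _ ->].
rewrite -ray_tnth; have [JlN [g g0 ->]] := @J_ray l.+1 (ltnW (ltn_ord l)).
have [JiN _] := J_ray (leqW i_le_n).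
rewrite defectE !cross_multiple crossD.
have [li|il] := leqP l.+1 i.
  have lJ : (J l.+1 <= J i <= N)%N by rewrite JiN J_homo // li leqW.
  have p_ge0 := cross_ge0_before lJ p1; have q_ge0 := cross_ge0_before lJ q1.
  have pq_ge0 := addr_ge0 p_ge0 q_ge0.
  move: (cross _ p) (cross _ q) p_ge0 q_ge0 pq_ge0 => cp cq p_ge0 q_ge0 pq_ge0.
  by rewrite !max_r ?mulrn_wge0 // mulrnDl subrr.
have lJ : (J i.+1 <= J l.+1 <= N)%N by rewrite JlN J_homo // il ltnW ?ltnS.
have p_le0 := cross_le0_after lJ p2; have q_le0 := cross_le0_after lJ q2.
have pq_le0 : cross (h (J l.+1)) p + cross (h (J l.+1)) q <= 0
    by rewrite -[0]addr0 lerD.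
move: (cross _ p) (cross _ q) p_le0 q_le0 pq_le0 => cp cq p_le0 q_le0 pq_le0.
by rewrite !max_l ?mulrn_wle0 // addr0 subr0.
Qed.

Lemma h_neq0 j : (j <= N)%N -> h j != 0.
Proof.
move=> jN; apply/eqP => j0; have := height_fan fanP jN; rewrite j0.
by rewrite -(mulr0n (h 0%N)) (height_first fanP).
Qed.

(** All ceilings are additive on a fan monoid, so the height is superadditive
    there; it is at least 1 on nonzero elements and exactly 1 at [h j]. *)
Lemma h_irreducible i j : (i <= n)%N -> (J i <= j <= J i.+1)%N ->
  irreducible_in (fan_monoid a b i) (h j).
Proof.
move=> i_le_n ij; have [Ji1N _] := @J_ray i.+1 i_le_n.
have jN : (j <= N)%N by case/andP: ij => _ /leq_trans; apply.
split; [exact/fan_monoid_h | exact: h_neq0 |].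
move=> q r Mq Mr hE; have [->|q0] := eqVneq q 0; [by left | right].
apply/eqP; apply: contraT => r0.
have := height_superadditive_flat slope_rays_pos fanP
  (fun t => fan_monoid_flat (t := t) i_le_n Mq Mr).
rewrite -hE (height_fan fanP jN).
by have := height_gt0 fanP q0; have := height_gt0 fanP r0; lia.
Qed.

(** The boundary rays of a cone are among the rays of the reduced fan, so a
    sector whose interior meets the cone is contained in it. *)
Lemma sector_in_monoid i j p x y : (i <= n)%N -> in_sector N h j p x y ->
  fan_monoid a b i p ->
  ((0 < x)%N -> fan_monoid a b i (h j)) /\
  ((0 < y)%N -> fan_monoid a b i (h j.+1)).
Proof.
move=> i_le_n [jN pE] /(fan_monoid_sectors _ i_le_n).
rewrite pE !crossD !crossMn => /andP[p1 p2].
have [JiN _] := J_ray (leqW i_le_n); have [Ji1N _] := @J_ray i.+1 i_le_n.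
split=> pos; apply/fan_monoid_h => //; first exact: ltnW; apply/andP; split;
    rewrite leqNgt; apply/negP => lt.
- move: p1; rewrite leNgt => /negP; apply; rewrite -[ltRHS]addr0 ltr_leD //.
    by rewrite pmulrn_llt0 // crossN oppr_lt0 hincr // lt.
  by rewrite mulrn_wle0 // hle0 // lt.
- move: p2; rewrite leNgt => /negP; apply; rewrite ltr_wpDr //.
    by rewrite mulrn_wge0 // hge0 // jN andbT ltnW // ltnW.
  by rewrite pmulrn_lgt0 // hincr // lt ltnW.
- move: p1; rewrite leNgt => /negP; apply; rewrite -[ltRHS]addr0 ler_ltD //.
    by rewrite mulrn_wle0 // hle0 // JiN andbT ltnW // ltnW.
  by rewrite pmulrn_llt0 // crossN oppr_lt0 hincr // lt.
- move: p2; rewrite leNgt => /negP; apply; rewrite ltr_wpDl //.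
    by rewrite mulrn_wge0 // hge0 // -ltnS lt ltnW.
  by rewrite pmulrn_lgt0 // hincr // lt.
Qed.

Definition sector_generators i : {fset nat * nat} :=
  [fset x in [seq h j | j <- iota (J i) (J i.+1 - J i).+1]]%fset.

Lemma sector_generatorsP i x : (i <= n)%N ->
  reflect (exists2 j, (J i <= j <= J i.+1)%N & x = h j)
      (x \in sector_generators i).
Proof.
move=> i_le_n; rewrite in_fset_seq.
apply: (iffP mapP) => -[j j_in ->]; exists j => //.
  by move: j_in; rewrite mem_iota addnS ltnS subnKC // J_mono.
by rewrite mem_iota addnS ltnS subnKC // J_mono.
Qed.

Lemma fan_hilbert_basisE i : (i <= n)%N ->
    fan_hilbert_basis a b i = sector_generators i.
Proof.
move=> i_le_n; apply: hilbert_basisE; apply: is_hilbert_basis_irreducible.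
- exact: fan_monoid0.
- by move=> p q; apply: fan_monoidD.
- by move=> p /(sector_generatorsP _ i_le_n)[j ij ->]; apply: h_irreducible.
move=> p Mp; have [j [x [y S]]] : exists j x y, in_sector N h j p x y.
  have [[x ->]|[j [x [y S]]]] := sector_cover fanP p; last by exists j, x, y.+1.
  exists 0%N, x, 0%N; split; last by rewrite mulr0n addr0.
  exact: fan_nonempty fanP.
have [Mx My] := sector_in_monoid i_le_n S Mp; have [jN pE] := S.
exists (nseq x (h j) ++ nseq y (h j.+1)).
  move=> q; rewrite mem_cat !mem_nseq =>
      /orP[/andP[x0 /eqP->]|/andP[y0 /eqP->]].
    by apply/sector_generatorsP => //; exists j => //; apply/fan_monoid_h;
      [|exact: ltnW|exact: Mx].
  by apply/sector_generatorsP => //; exists j.+1 => //; apply/fan_monoid_h;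
    [| |exact: My].
rewrite big_cat /= pE; congr (_ + _).
  by rewrite big_nseq; elim: (x) => [|k IH]; rewrite ?mulr0n // mulrS iterS -IH.
by rewrite big_nseq; elim: (y) => [|k IH]; rewrite ?mulr0n // mulrS iterS -IH.
Qed.

Lemma card_h_iota m k : (m + k <= N)%N ->
  #|` [fset x in [seq h j | j <- iota m k.+1]]%fset| = k.+1.
Proof.
move=> mk; rewrite card_fseq undup_id ?size_map ?size_iota //
    map_inj_in_uniq ?iota_uniq //.
move=> i j; rewrite !mem_iota => /andP[_ i_lt] /andP[_ j_lt].
by apply: (fan_inj fanP); lia.
Qed.

(** The i-th basis is indexed by the interval from [J i] to [J i.+1], and the
    lengths of these intervals telescope. *)
Lemma sum_card_fan_hilbert_basis :
  (\sum_(i < n.+1) #|` fan_hilbert_basis a b i| = N + n.+1)%N.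
Proof.
have E m : (m <= n.+1)%N ->
    (\sum_(i < m) #|` fan_hilbert_basis a b i| = J m + m)%N.
  elim: m => [|m IH] mn; first by rewrite big_ord0 J0.
  rewrite big_ord_recr /= IH 1?ltnW // fan_hilbert_basisE //.
  have Jm := J_mono mn; have [Jm1N _] := @J_ray m.+1 mn.
  by rewrite card_h_iota ?subnKC //; lia.
by rewrite E // Jlast.
Qed.

Lemma hilbert_numberE : hilbert_number a b = N.+1.
Proof.
rewrite /hilbert_number.
have -> : hilbert_set a b = [fset x in [seq h j | j <- iota 0 N.+1]]%fset.
  apply/fsetP => x; rewrite in_fset_seq; apply/bigfcupP/mapP.
    move=> [i _]; rewrite fan_hilbert_basisE -1?ltnS //.
    move=> /sector_generatorsP[]; rewrite -1?ltnS //.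
    move=> j /andP[_ ji] ->; exists j => //; rewrite mem_iota /= add0n ltnS.
    by have [Ji1N _] := @J_ray i.+1 (ltn_ord i); apply: leq_trans ji _.
  move=> [j]; rewrite mem_iota /= add0n ltnS => jN ->.
  have [i i_le_n Mi] := fan_monoid_cover (h j).
  exists (Ordinal (i_le_n : (i < n.+1)%N)); first by rewrite mem_index_enum.
  rewrite fan_hilbert_basisE //; apply/sector_generatorsP => //; exists j => //.
  exact/fan_monoid_h.
exact: card_h_iota.
Qed.

End FanMonoids.

(** * Lengths of quotients from a triangular system of coordinates *)

Section Length.
Variables (A : comNzRingType) (K : fieldType) (l : nat) (J : set A).
Variables (chi : 'I_l -> A -> K) (scalar : K -> A) (e : 'I_l -> A).
Hypothesis chiD : forall i x y, chi i (x + y) = chi i x + chi i y.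
Hypothesis chiZ : forall i c x, chi i (scalar c * x) = c * chi i x.
Hypothesis chi_dual : forall i j, chi i (e j) = (i == j)%:R.
Hypothesis chi_ker : forall x, J x <-> forall i, chi i x = 0.
Hypothesis chi_triangular : forall (m : nat) c x,
  (forall i : 'I_l, (m <= i)%N -> chi i x = 0) ->
  forall i : 'I_l, (m <= i)%N -> chi i (c * x) = 0.

Let chi0 i : chi i 0 = 0.
Proof. by apply: (addrI (chi i 0)); rewrite -chiD !addr0. Qed.

Let chiN i x : chi i (- x) = - chi i x.
Proof. by apply: (addrI (chi i x)); rewrite -chiD !subrr chi0. Qed.

Let chi_sum i (I : Type) (s : seq I) (F : I -> A) :
  chi i (\sum_(j <- s) F j) = \sum_(j <- s) chi i (F j).
Proof. exact: (big_morph _ (chiD i) (chi0 i)). Qed.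

Lemma ideal_sum (c : set A) (I : Type) (s : seq I) (P : pred I) (F : I -> A) :
  is_ideal c -> (forall i, P i -> c (F i)) -> c (\sum_(i <- s | P i) F i).
Proof. by move=> [c0 cD _] cF; apply: (big_ind c). Qed.

(** Elements chosen from the successive differences of the chain have
    independent coordinates: in a vanishing combination the last term with a
    nonzero coefficient would lie in the ideal before it. *)
Lemma chain_length_le (m : nat) (c : nat -> set A) : ideal_chain J m c ->
    (m <= l)%N.
Proof.
move=> [c_ideal Jc c_strict].
have c_mono i j : (i <= j <= m)%N -> forall x, c i x -> c j x.
  move=> /andP[]; elim: j => [|j IH]; first by rewrite leqn0 => /eqP->.
  rewrite leq_eqVlt => /orP[/eqP->//|ij] jm x cx.
  by apply: (proj1 (c_strict j jm)); apply: IH => //; apply: ltnW.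
have /choice[f fP] : forall i : 'I_m, exists x, c i.+1 x /\ ~ c i x.
  move=> i; have [_ /existsNP[x /not_implyP[? ?]]] := c_strict i (ltn_ord i).
  by exists x.
pose M := \matrix_(i < m, j < l) chi j (f i).
suff : row_free M by rewrite /row_free => /eqP <-; apply: rank_leq_col.
apply: inj_row_free => v vM0; apply/eqP; apply: contraT => v_neq0.
have [i0 vi0] : exists i0, v ord0 i0 != 0.
  apply/existsP; apply: contraR v_neq0 => /existsPn v0.
  by apply/eqP/rowP => i; rewrite mxE; apply/eqP; rewrite -[_ == _]negbK v0.
have [i vi i_max] := @arg_maxnP _ i0 [pred i | v ord0 i != 0]
  (@nat_of_ord m) vi0.
have im := ltn_ord i; have ci := c_ideal i (ltnW im); have [_ ciD ciM] := ci.
have ciN x : c i x -> c i (- x) by move=> /(ciM (-1)); rewrite mulN1r.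
have J_ci x : J x -> c i x by move=> /Jc; apply: c_mono; rewrite /= ltnW.
pose g := \sum_j scalar (v ord0 j) * f j.
have g_ci : c i g.
  apply: J_ci; apply/chi_ker => j; rewrite chi_sum.
  transitivity ((v *m M) ord0 j); last by rewrite vM0 mxE.
  rewrite mxE; apply: eq_bigr => k _.
  by rewrite chiZ !mxE.
have lead_ci : c i (scalar (v ord0 i) * f i).
  have -> : scalar (v ord0 i) * f i = g - \sum_(j | j != i) scalar (v ord0 j) * f j.
    by rewrite /g (bigD1 i) //= addrK.
  apply: ciD => //; apply: ciN; apply: ideal_sum => // j ji.
  have [vj|vj] := eqVneq (v ord0 j) 0.
    by apply: J_ci; apply/chi_ker => k; rewrite chiZ vj mul0r.
  apply: ciM; have [fj _] := fP j; apply: c_mono fj.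
  by rewrite (ltnW im) andbT ltn_neqAle ji; apply: i_max.
have [_] := fP i; case;
  rewrite -[f i](subrKC (scalar (v ord0 i)^-1 * (scalar (v ord0 i) * f i))).
apply: ciD; first exact: ciM.
by apply: J_ci; apply/chi_ker => j; rewrite chiD chiN !chiZ mulKf // subrr.
Qed.

(** The vectors whose coordinates vanish from the m-th one on form an ideal,
    because multiplication is triangular; these ideals are a chain of maximal
    length. *)
Lemma quotient_has_length_coordinates : quotient_has_length J l.
Proof.
split; last by move=> m c; apply: chain_length_le.
exists (fun m => [set x : A | forall i : 'I_l, (m <= i)%N ->
    chi i x = 0]%classic).
split=> [m _|x /chi_ker Jx i _ //|m ml].
  split=> [i _|x y xP yP i mi|c x]; first exact: chi0.
    by rewrite chiD xP ?yP ?addr0.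
  exact: chi_triangular.
split=> [x xP i mi|sub]; first by apply: xP; apply: ltnW.
have /sub/(_ (Ordinal ml) (leqnn m)) : forall i : 'I_l, (m.+1 <= i)%N ->
    chi i (e (Ordinal ml)) = 0.
  by move=> i mi; rewrite chi_dual -val_eqE /= gtn_eqF.
by rewrite chi_dual eqxx => /eqP; rewrite oner_eq0.
Qed.

End Length.

(** * The monomial structure of the intersection algebra *)

Definition pair_mnm (p : nat * nat) : 'X_{1..2} :=
  [multinom (if i == ord0 then p.1 else p.2) | i < 2].

Lemma pair_mnmD p q : pair_mnm (p + q) = (pair_mnm p + pair_mnm q)%MM.
Proof. by apply/mnmP => i; rewrite mnmDE !mnmE; case: ifP. Qed.

Lemma pair_mnmK (m : 'X_{1..2}) : pair_mnm (m ord0, m ord_max) = m.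
Proof.
apply/mnmP => i; rewrite mnmE; case: eqP => [->//|/eqP i0].
by congr (m _); apply: val_inj => /=; case: i i0 => -[|[|]].
Qed.

Lemma pair_mnm_inj : injective pair_mnm.
Proof.
move=> p q /mnmP pq; have := pq ord0; have := pq ord_max.
by rewrite !mnmE /=; case: p q {pq} => ? ? [? ?] /= -> ->.
Qed.

Section MonomialIdeals.
Variables (K : fieldType) (n : nat).

Lemma monomial_ideal_supp (c : n.-tuple nat) (g : {mpoly K[n]}) :
  monomial_ideal c g -> forall t, t \in msupp g ->
      forall i, (tnth c i <= t i)%N.
Proof.
pose S : set {mpoly K[n]} := [set g | forall t, t \in msupp g ->
    forall i, (tnth c i <= t i)%N]%classic.
suff S_ideal : is_ideal S.
  move=> /(_ S); apply; split=> // _ /= -> t; rewrite msuppX inE => /eqP-> i.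
  by rewrite multinomE.
split=> [t|x y xS yS t|x y yS t]; first by rewrite msupp0.
  by move=> /msuppD_le; rewrite mem_cat => /orP[/xS|/yS].
move=> /msuppM_le/allpairsP[[t1 t2] [_ /yS t2S ->]] i.
by rewrite mnmDE (leq_trans (t2S i)) ?leq_addl.
Qed.

Lemma ideal_pow_monomialP (c : n.-tuple nat) k (g : {mpoly K[n]}) :
  ideal_pow (monomial_ideal c) k g <->
  forall t, t \in msupp g -> forall i, (tnth c i * k <= t i)%N.
Proof.
have P_ideal : is_ideal (ideal_pow (@monomial_ideal K n c) k) :=
    ideal_gen_ideal _.
split.
  pose S : set {mpoly K[n]} := [set g | forall t, t \in msupp g ->
      forall i, (tnth c i * k <= t i)%N]%classic.
  suff S_ideal : is_ideal S.
    move=> /(_ S); apply; split=> // _ [f cf ->] t.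
    have : forall m (F : 'I_m -> {mpoly K[n]}),
      (forall i, monomial_ideal c (F i)) ->
      forall t, t \in msupp (\prod_(i < m) F i) ->
          forall i, (tnth c i * m <= t i)%N.
      elim=> [|m IH] F cF t'; first by move=> _ i; rewrite muln0.
      rewrite big_ord_recl => /msuppM_le/allpairsP[[t1 t2] [/= t1s t2s ->]] i.
      rewrite mnmDE mulnS leq_add //;
        first exact: monomial_ideal_supp (cF _) _ t1s i.
      by apply: IH t2s i => j; apply: cF.
    by apply.
  split=> [t|x y xS yS t|x y yS t]; first by rewrite msupp0.
    by move=> /msuppD_le; rewrite mem_cat => /orP[/xS|/yS].
  move=> /msuppM_le/allpairsP[[t1 t2] [_ /yS t2S ->]] i.
  by rewrite mnmDE (leq_trans (t2S i)) ?leq_addl.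
move=> g_supp; rewrite [g]mpolyE big_seq; apply: ideal_sum => // t t_supp.
have [_ _ PM] := P_ideal; rewrite -mul_mpolyC; apply: (PM).
have tE : t = ((t - Multinom c *+ k) + Multinom c *+ k)%MM.
  rewrite submK //; apply/mnm_lepP => i; rewrite mulmnE multinomE.
  exact: g_supp.
rewrite tE mpolyXD; apply: PM; apply: ideal_gen_sub.
exists (fun=> 'X_[Multinom c]) => [_|]; first exact: ideal_gen_sub.
by rewrite prodr_const card_ord mpolyXn.
Qed.

End MonomialIdeals.

Section Coefficients.
Variables (K : fieldType) (n : nat).
Notation Ruv := {mpoly {mpoly K[n]}[2]}.
Notation exponent := (nat * nat * 'X_{1..n})%type.

Definition exponent_add (q r : exponent) : exponent :=
    (q.1 + r.1, (q.2 + r.2)%MM).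

Definition coef (f : Ruv) (q : exponent) : K := (f@_(pair_mnm q.1))@_(q.2).

Lemma coefD f g q : coef (f + g) q = coef f q + coef g q.
Proof. by rewrite /coef !mcoeffD. Qed.

Lemma coef0 q : coef 0 q = 0.
Proof. by rewrite /coef !mcoeff0. Qed.

Lemma coefZ c f q : coef (c%:MP%:MP * f) q = c * coef f q.
Proof. by rewrite /coef !mcoeffCM. Qed.

Lemma coef_sum (I : Type) (s : seq I) (F : I -> Ruv) q :
  coef (\sum_(i <- s) F i) q = \sum_(i <- s) coef (F i) q.
Proof. exact: (big_morph (coef^~ q) (fun f g => coefD f g q) (coef0 q)). Qed.

Lemma coef_ext f g : (forall q, coef f q = coef g q) -> f = g.
Proof.
move=> fg; apply/mpolyP => m; apply/mpolyP => t.
by have := fg ((m ord0, m ord_max), t); rewrite /coef pair_mnmK.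
Qed.

Lemma coefM_supp f g q : coef (f * g) q != 0 ->
  exists q1 q2, [/\ coef f q1 != 0, coef g q2 != 0 & q = exponent_add q1 q2].
Proof.
move=> fg; have [m1 [m2 [mE t_supp]]] : exists m1 m2,
    pair_mnm q.1 = (m1 + m2)%MM /\ q.2 \in msupp (f@_m1 * g@_m2).
  move: fg; rewrite /coef -mcoeff_msupp mcoeffM =>
      /msupp_sum_le/flatten_mapP[[m1 m2]].
  by rewrite mem_filter /= => /andP[/eqP mE _] ?; exists m1, m2.
move: t_supp => /msuppM_le/allpairsP[[t1 t2] /= [s1 s2 tE]] {fg}.
exists ((m1 ord0 : nat, m1 ord_max : nat), t1).
exists ((m2 ord0 : nat, m2 ord_max : nat), t2).
rewrite /coef /= !pair_mnmK -!mcoeff_msupp; split=> //.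
case: q mE tE => qp qt /= mE ->; congr pair; apply: pair_mnm_inj.
by rewrite mE pair_mnmD !pair_mnmK.
Qed.

Lemma QmonomialE (q : exponent) :
    Qmonomial K q = ('X_[q.2])%:MP * 'X_[pair_mnm q.1].
Proof.
rewrite /Qmonomial !mpolyXn -mulrA -mpolyXD; congr (_ * 'X_[_]).
apply/mnmP => i; rewrite mnmDE !mulmnE !mnm1E mnmE.
by case: i => -[|[|//]] ilt; rewrite -!val_eqE /= ?mul1n ?mul0n ?addn0 ?add0n.
Qed.

Lemma coef_Qmonomial q q' : coef (Qmonomial K q) q' = (q == q')%:R.
Proof.
rewrite QmonomialE /coef mcoeffCM mcoeffX (inj_eq pair_mnm_inj).
case: q q' => [p t] [p' t'] /=; rewrite xpair_eqE.
by case: (p == p'); rewrite ?mulr1 ?mulr0 ?mcoeffX ?mcoeff0.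
Qed.

Lemma coef_Qmonomial_supp q q' : coef (Qmonomial K q) q' != 0 -> q = q'.
Proof. by rewrite coef_Qmonomial; case: (q =P q') => // _; rewrite eqxx. Qed.

Lemma Qmonomial_add q r :
    Qmonomial K (exponent_add q r) = Qmonomial K q * Qmonomial K r.
Proof. by rewrite !QmonomialE /= pair_mnmD !mpolyXD mpolyCM mulrACA. Qed.

Lemma coef_supp_seq f :
  exists2 s : seq exponent, uniq s & forall q, coef f q != 0 -> q \in s.
Proof.
exists (undup [seq ((m ord0 : nat, m ord_max : nat), t) |
                m : 'X_{1..2} <- msupp f, t : 'X_{1..n} <- msupp f@_m]).
  exact: undup_uniq.
move=> [[r s] t]; rewrite /coef /= -mcoeff_msupp mem_undup => t_supp.
apply/allpairsPdep; exists (pair_mnm (r, s)), t; split=> //;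
  last by rewrite !mnmE.
by rewrite mcoeff_msupp; apply: contraTneq t_supp => ->; rewrite msupp0.
Qed.

Lemma coef_expand f s : uniq s -> (forall q, coef f q != 0 -> q \in s) ->
  f = \sum_(q <- s) (coef f q)%:MP%:MP * Qmonomial K q.
Proof.
move=> s_uniq f_s; apply: coef_ext => q; rewrite coef_sum.
under eq_bigr do rewrite coefZ coef_Qmonomial mulr_natr mulrb.
have [qs|qs] := boolP (q \in s).
  rewrite (bigD1_seq q) //= eqxx big1 ?addr0 // => i.
  by move/negbTE->.
rewrite big_seq big1 => [|i].
  by apply/eqP; apply: contraR qs; apply: f_s.
by case: eqP => [->|//]; rewrite (negbTE qs).
Qed.

Variables (a b : n.-tuple nat).
Notation B := (intersection_algebra K a b).

Lemma intersection_predP (f : Ruv) :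
  reflect (forall q, coef f q != 0 -> Qset a b q) (f \in intersection_pred a b).
Proof.
apply: (iffP (asboolP _)) => [fP [p t] /=|fQ m].
  rewrite /coef /= -mcoeff_msupp => t_supp i.
  have [/ideal_pow_monomialP/(_ _ t_supp i) fa /ideal_pow_monomialP/(_ _ t_supp i) fb] :=
    fP (pair_mnm p).
  by move: fa fb; rewrite !mnmE /= geq_max => -> ->.
split; apply/ideal_pow_monomialP => t t_supp i;
  have := fQ ((m ord0 : nat, m ord_max : nat), t);
  by rewrite /coef pair_mnmK -mcoeff_msupp => /(_ t_supp i);
    rewrite geq_max => /andP[].
Qed.

Lemma ia_supp (f : B) q : coef (ia_val f) q != 0 -> Qset a b q.
Proof. by apply/intersection_predP; case: f. Qed.

Lemma ia_coefM_supp (f g : B) q : coef (ia_val (f * g)) q != 0 ->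
  exists q1 q2, [/\ coef (ia_val f) q1 != 0, coef (ia_val g) q2 != 0 &
    q = exponent_add q1 q2].
Proof. exact: coefM_supp. Qed.

(** [insubd] needs a value for arguments outside the algebra; constants are
    never outside. *)
Definition ia_const (c : K) : B := insubd (0 : B) c%:MP%:MP.

(** The value is 0 if [q] is not in Q. *)
Definition ia_monomial (q : exponent) : B := insubd (0 : B) (Qmonomial K q).

Lemma ia_constE c : ia_val (ia_const c) = c%:MP%:MP.
Proof.
apply: insubdK; apply/intersection_predP => -[p t].
rewrite /coef mcoeffC mulr_natr mulrb /=.
case: (pair_mnm p =P 0%MM) => [p0 _ i|_]; last by rewrite mcoeff0 eqxx.
rewrite /=; suff -> : p = (0, 0)%N by rewrite /= !muln0.
by apply: pair_mnm_inj; rewrite p0; apply/mnmP => j; rewrite !mnmE if_same.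
Qed.

Lemma ia_monomialE q : Qset a b q -> ia_val (ia_monomial q) = Qmonomial K q.
Proof.
move=> qQ; apply: insubdK; apply/intersection_predP => q'.
by move=> /coef_Qmonomial_supp <-.
Qed.

Lemma ia_expand (f : B) s : uniq s ->
  (forall q, coef (ia_val f) q != 0 -> q \in s) ->
  f = \sum_(q <- s) ia_const (coef (ia_val f) q) * ia_monomial q.
Proof.
move=> s_uniq f_s; apply: val_inj;
  rewrite raddf_sum /= [LHS](coef_expand s_uniq f_s).
apply: eq_bigr => q _; rewrite /= ia_constE.
have [->|/ia_supp/ia_monomialE -> //] := eqVneq (coef (ia_val f) q) 0.
by rewrite !mul0r.
Qed.

Lemma Qset_add q r : Qset a b q -> Qset a b r -> Qset a b (exponent_add q r).
Proof.
move=> qQ rQ i; rewrite mnmDE; have := qQ i; have := rQ i.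
by rewrite !geq_max /= !mulnDr => /andP[? ?] /andP[? ?]; rewrite !leq_add.
Qed.

(** What is used of the order function of Q: it is superadditive, positive away
    from 0, and a nonzero summand can be split off at the cost of one. *)
Variable ord : exponent -> nat.
Hypothesis ord_superadditive : forall q r, Qset a b q -> Qset a b r ->
  (ord q + ord r <= ord (exponent_add q r))%N.
Hypothesis ord_gt0 : forall q, Qset a b q -> q <> (0%N, 0%N, 0%MM) ->
    (0 < ord q)%N.
Hypothesis ord_split : forall q, Qset a b q -> (0 < ord q)%N ->
  exists q1 q2, [/\ Qset a b q1, Qset a b q2, q1 <> (0%N, 0%N, 0%MM),
     q = exponent_add q1 q2 & ((ord q).-1 <= ord q2)%N].

Lemma ord_leq_add q r : Qset a b q -> Qset a b r ->
    (ord r <= ord (exponent_add q r))%N.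
Proof. by move=> qQ rQ; apply: leq_trans (ord_superadditive qQ rQ);
  apply: leq_addl. Qed.

(** Multiplication by an element of the algebra adds an element of Q to the
    exponents, which does not lower the order. *)
Lemma ord_ideal k : is_ideal
  [set f : B | forall q, coef (ia_val f) q != 0 -> (k <= ord q)%N]%classic.
Proof.
split=> [q|f g fP gP q|c f fP q] /=; first by rewrite coef0 eqxx.
  rewrite coefD => fg; have [f0|/fP //] := eqVneq (coef (ia_val f) q) 0.
  by apply: gP; move: fg; rewrite f0 add0r.
move=> /ia_coefM_supp[q1 [q2 [c1 f2 ->]]].
by apply: leq_trans (fP _ f2) (ord_leq_add (ia_supp c1) (ia_supp f2)).
Qed.

Lemma max_ideal_ord (f : B) q : @max_ideal K n a b f ->
  coef (ia_val f) q != 0 -> (0 < ord q)%N.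
Proof.
move=> /(_ _ (conj (ord_ideal 1) _)); apply=> f' [q' [q'Q q'0 fE]] q''.
by rewrite fE => /coef_Qmonomial_supp <-; apply: ord_gt0.
Qed.

Lemma max_ideal_pow_ord k (f : B) q : ideal_pow (@max_ideal K n a b) k f ->
  coef (ia_val f) q != 0 -> (k <= ord q)%N.
Proof.
move=> /(_ _ (conj (ord_ideal k) _)); apply=> _ [g gI ->] {q f}.
have : forall m (F : 'I_m -> B), (forall i, @max_ideal K n a b (F i)) ->
  forall q, coef (ia_val (\prod_(i < m) F i)) q != 0 -> (m <= ord q)%N.
  elim=> [//|m IH] F FI q.
  rewrite big_ord_recl => /ia_coefM_supp[q1 [q2 [c1 c2 ->]]].
  apply: leq_trans (ord_superadditive (ia_supp c1) (ia_supp c2)).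
  by rewrite -add1n leq_add ?(max_ideal_ord (FI _) c1) // (IH _ _ _ c2).
exact.
Qed.

Lemma ia_monomial_pow k q : Qset a b q -> (k <= ord q)%N ->
  ideal_pow (@max_ideal K n a b) k (ia_monomial q).
Proof.
elim: k q => [|k IH] q qQ kq.
  have [_ _ PM] := ideal_gen_ideal [set x | exists2 f : 'I_0 -> B,
     (forall i, max_ideal (f i)) & x = \prod_(i < 0) f i]%classic.
  by rewrite -[ia_monomial q]mulr1; apply: PM; apply: ideal_pow01.
have [q1 [q2 [q1Q q2Q q10 qE q2k]]] := ord_split qQ (leq_trans (ltn0Sn k) kq).
have -> : ia_monomial q = ia_monomial q1 * ia_monomial q2.
  by apply: val_inj; rewrite /= !ia_monomialE // qE Qmonomial_add.
rewrite -add1n; apply: ideal_powM; last by apply: IH => //;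
  apply: leq_trans q2k; lia.
apply: ideal_gen_sub; exists (fun=> ia_monomial q1); last by rewrite big_ord1.
by move=> _; apply: ideal_gen_sub; exists q1; split=> //; apply: ia_monomialE.
Qed.

(** By superadditivity a product of k elements of the ideal has order at least
    k.  Conversely a monomial of order at least k splits off k nonzero monomials
    one after the other. *)
Lemma max_ideal_powP k (f : B) : ideal_pow (@max_ideal K n a b) k f <->
  forall q, coef (ia_val f) q != 0 -> (k <= ord q)%N.
Proof.
split=> [fI q|fP]; first exact: max_ideal_pow_ord.
have pow_ideal : is_ideal (ideal_pow (@max_ideal K n a b) k) :=
    ideal_gen_ideal _.
have [s s_uniq f_s] := coef_supp_seq (ia_val f).
rewrite (ia_expand s_uniq f_s); apply: ideal_sum => // q _.
have [P0 _ PM] := pow_ideal.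
have [->|fq] := eqVneq (coef (ia_val f) q) 0.
  suff -> : ia_const 0 = 0 by rewrite mul0r.
  by apply: val_inj; rewrite /= ia_constE.
by apply: (PM); apply: ia_monomial_pow; [apply: ia_supp fq | apply: fP].
Qed.

(** The coordinates are the coefficients of the monomials of order less than
    k.  Listed by decreasing order they are triangular, since a product with a
    nonconstant monomial has larger order. *)
Lemma quotient_length_max_ideal_pow k (E : seq exponent) : uniq E ->
  (forall q, q \in E <-> Qset a b q /\ (ord q < k)%N) ->
  quotient_has_length (ideal_pow (@max_ideal K n a b) k) (size E).
Proof.
move=> E_uniq E_mem; pose s := sort (fun q r => (ord r <= ord q)%N) E.
have s_mem q : q \in s <-> Qset a b q /\ (ord q < k)%N by rewrite mem_sort.
have s_uniq : uniq s by rewrite sort_uniq.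
have -> : size E = size s by rewrite size_sort.
have s_sorted : sorted (fun q r => (ord r <= ord q)%N) s.
  by apply: sort_sorted => q r; apply: leq_total.
pose q_ (i : 'I_(size s)) := tnth (in_tuple s) i.
have q_s i : q_ i \in s by apply: mem_tnth.
have q_inj : injective q_ by apply/tuple_uniqP.
have q_Q i : Qset a b (q_ i) by have /s_mem[] := q_s i.
have q_onto q : q \in s -> exists i, q = q_ i by move=> /(tnthP (in_tuple s)).
have q_ord (i j : 'I_(size s)) : (i <= j)%N -> (ord (q_ j) <= ord (q_ i))%N.
  move=> ij; rewrite /q_ !(tnth_nth (q_ i)) /=.
  apply: (sorted_leq_nth _ _ _ s_sorted) => //; rewrite ?inE //.
  by move=> x y z xy yz; apply: leq_trans yz xy.
apply: (@quotient_has_length_coordinates _ K _ _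
  (fun i f => coef (ia_val f) (q_ i)) ia_const (fun i => ia_monomial (q_ i))).
- by move=> i f g; apply: coefD.
- by move=> i c f; rewrite /= ia_constE coefZ.
- by move=> i j; rewrite ia_monomialE // coef_Qmonomial (inj_eq q_inj) eq_sym.
- move=> f; rewrite max_ideal_powP; split=> [fP i|fP q fq].
    apply/eqP; apply: contraT => /fP; have /s_mem[_] := q_s i.
    by rewrite ltnNge => /negP.
  rewrite leqNgt; apply/negP => qk.
  have /q_onto[i qi] : q \in s by apply/s_mem; split=> //; apply: ia_supp fq.
  by rewrite qi fP eqxx in fq.
- move=> m c f fP i mi; apply/eqP;
    apply: contraT => /ia_coefM_supp[q1 [q2 [c1 f2 qE]]].
  have q1Q := ia_supp c1; have q2Q := ia_supp f2; have /s_mem[_ ik] := q_s i.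
  have q2_le : (ord q2 <= ord (q_ i))%N by rewrite qE ord_leq_add.
  have /q_onto[j q2E] : q2 \in s by apply/s_mem; split=> //;
    apply: leq_ltn_trans ik.
  have [/fP fj|jm] := leqP m j; first by rewrite q2E fj eqxx in f2.
  have q1_neq0 : q1 <> (0%N, 0%N, 0%MM).
    move=> q10; move: qE;
      rewrite q10 q2E /exponent_add /= !add0r add0m -surjective_pairing.
    by move/q_inj => ij; move: jm; rewrite -ij ltnNge mi.
  have := ord_superadditive q1Q q2Q; rewrite -qE; have := ord_gt0 q1Q q1_neq0.
  by have := q_ord j i (ltnW (leq_trans jm mi)); rewrite q2E; lia.
Qed.

End Coefficients.

(** * Counting *)

Section Simplex.

Definition mnm_tail m (w : 'X_{1..m.+1}) : 'X_{1..m} :=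
    [multinom w (lift ord0 i) | i < m].

Definition mnm_cons m x (w : 'X_{1..m}) : 'X_{1..m.+1} :=
  [multinom (if unlift ord0 i is Some j then w j else x) | i < m.+1].

Lemma mnm_cons0 m x (w : 'X_{1..m}) : mnm_cons x w ord0 = x.
Proof. by rewrite mnmE unlift_none. Qed.

Lemma mnm_consK m x (w : 'X_{1..m}) : mnm_tail (mnm_cons x w) = w.
Proof. by apply/mnmP => i; rewrite !mnmE liftK. Qed.

Lemma mnm_cons_inj m (w w' : 'X_{1..m.+1}) :
  w ord0 = w' ord0 -> mnm_tail w = mnm_tail w' -> w = w'.
Proof.
move=> w0 /mnmP wt; apply/mnmP => i; case: (unliftP ord0 i) => [j|] -> //.
by have := wt j; rewrite !mnmE.
Qed.

Lemma mdeg_tail m (w : 'X_{1..m.+1}) : mdeg w = (w ord0 + mdeg (mnm_tail w))%N.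
Proof.
rewrite !mdegE big_ord_recl; congr addn.
by apply: eq_bigr => i _; rewrite mnmE.
Qed.

(** The exponents of degree less than k.  The tuples are counted by a bound
    that their sum may reach, hence the shift and the empty case k = 0. *)
Definition simplex m k : seq 'X_{1..m} :=
  if k is k'.+1 then
    [seq [multinom of map val t] | t : m.-tuple 'I_k'.+1 <-
       enum [set t : m.-tuple 'I_k'.+1 | (\sum_(i <- t) i <= k')%N]]
  else [::].

Lemma mem_simplex m k (w : 'X_{1..m}) : (w \in simplex m k) = (mdeg w < k)%N.
Proof.
case: k => [|k] //=; have degE (t : m.-tuple 'I_k.+1) :
    mdeg [multinom of map val t] = (\sum_(i <- t) i)%N by rewrite /mdeg big_map.
apply/mapP/idP => [[t]|w_deg]; first by rewrite mem_enum inE => t_le ->;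
  rewrite degE.
have w_lt i : (w i < k.+1)%N.
  by apply: leq_ltn_trans w_deg; rewrite mdegE (bigD1 i) //= leq_addr.
have wE : w = [multinom of map val [tuple (Ordinal (w_lt i)) | i < m]].
  by apply/mnmP => i; rewrite multinomE tnth_map tnth_mktuple.
by exists [tuple (Ordinal (w_lt i)) | i < m] => //;
  rewrite mem_enum inE -degE -wE.
Qed.

Lemma simplex_uniq m k : uniq (simplex m k).
Proof.
case: k => [|k] //=; rewrite map_inj_uniq ?enum_uniq //.
by move=> t t' [] /(inj_map val_inj) /val_inj.
Qed.

Lemma size_simplex m k : (0 < m)%N -> size (simplex m k) = 'C((m + k).-1, m).
Proof.
move=> m0; case: k => [|k] /=; first by rewrite addn0 bin_small // prednK.
by rewrite size_map -cardE card_partial_ord_partitions addnS.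
Qed.

End Simplex.

Section AdicOrder.
Variables (n : nat) (a b : n.-tuple nat).
Hypothesis a_gt0 : forall i : 'I_n, (0 < tnth a i)%N.
Hypothesis b_gt0 : forall i : 'I_n, (0 < tnth b i)%N.
Variables (N : nat) (h : nat -> nat * nat).
Hypothesis fanP : reduced_fan (slope_rays a b) N h.
Notation exponent := (nat * nat * 'X_{1..n})%type.

Let Tpos := slope_rays_pos a_gt0 b_gt0.

(** The least exponent of x over [p] in Q. *)
Definition floor_mnm (p : nat * nat) : 'X_{1..n} :=
  [multinom ceiling (tnth b i, tnth a i) p | i < n].

(** The largest number of nonzero elements of Q with sum [q], which is also
    the largest power of the maximal ideal that contains the monomial of [q]. *)
Definition adic_order (q : exponent) : nat :=
  (`|height N h q.1| + mdeg (q.2 - floor_mnm q.1)%MM)%N.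

Lemma QsetE q : Qset a b q <-> (floor_mnm q.1 <= q.2)%MM.
Proof.
split=> [qQ|/mnm_lepP qQ i]; last by have := qQ i; rewrite mnmE.
by apply/mnm_lepP => i; rewrite mnmE; apply: qQ.
Qed.

Lemma mdeg_above q : Qset a b q ->
  mdeg q.2 = (mdeg (q.2 - floor_mnm q.1)%MM + mdeg (floor_mnm q.1))%N.
Proof. by move=> /QsetE qQ; rewrite -mdegD submK. Qed.

Lemma height_ge0 p : 0 <= height N h p.
Proof.
have [->|/(height_gt0 fanP)/ltW//] := eqVneq p 0.
by rewrite -(mulr0n (h 0%N)) (height_first fanP).
Qed.

Lemma sum_defect p q : \sum_(t <- slope_rays a b) defect t p q =
  (mdeg (floor_mnm p))%:Z + (mdeg (floor_mnm q))%:Z -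
  (mdeg (floor_mnm (p + q)))%:Z.
Proof.
rewrite !mdegE -!natz !natr_sum -big_split -sumrB /= /slope_rays big_map big_enum /=.
by apply: eq_bigr => i _; rewrite /defect !natz !mnmE.
Qed.

(** The superadditivity of the height up to the defects of the ceilings, in
    terms of degrees. *)
Lemma adic_order_superadditive q r : Qset a b q -> Qset a b r ->
  (adic_order q + adic_order r <= adic_order (exponent_add q r))%N.
Proof.
move=> qQ rQ; have := height_superadditive Tpos fanP q.1 r.1.
rewrite sum_defect; have := mdeg_above (Qset_add qQ rQ).
have := mdeg_above qQ; have := mdeg_above rQ; rewrite /adic_order /= mdegD.
have := height_ge0 q.1; have := height_ge0 r.1; have := height_ge0 (q.1 + r.1);
  lia.
Qed.

Lemma floor_mnm0 : floor_mnm 0 = 0%MM.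
Proof. by apply/mnmP => i; rewrite !mnmE /ceiling !muln0. Qed.

Lemma adic_order_gt0 q : Qset a b q -> q <> (0%N, 0%N, 0%MM) ->
    (0 < adic_order q)%N.
Proof.
case: q => p t _ q0; rewrite /adic_order /=;
  have [p0|/(height_gt0 fanP)] := eqVneq p 0; last by lia.
rewrite p0 floor_mnm0 subm0 addn_gt0 [X in _ || X]lt0n mdeg_eq0.
by apply/orP; right; apply/eqP => t0; apply: q0; rewrite p0 t0.
Qed.

Lemma adic_order_on_floor p w :
    adic_order (p, floor_mnm p + w)%MM = (`|height N h p| + mdeg w)%N.
Proof. by rewrite /adic_order /= addmC addmK. Qed.

Lemma sector_peel p : p != 0 -> exists p1 p2 j x1 y1 x2 y2,
  [/\ p = p1 + p2, p1 != 0, in_sector N h j p1 x1 y1, in_sector N h j p2 x2 y2 &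
     height N h p = 1 + height N h p2].
Proof.
have N0 := fan_nonempty fanP.
have h_neq0 j : (j <= N)%N -> h j != 0.
  move=> jN; apply/eqP => j0; have := height_fan fanP jN; rewrite j0.
  by rewrite -(mulr0n (h 0%N)) (height_first fanP).
have [[[|x] ->]|[j [x [y S]]]] := sector_cover fanP p;
  first by rewrite mulr0n eqxx.
  move=> _; exists (h 0%N), (h 0%N *+ x), 0%N, 1%N, 0%N, x, 0%N; split.
  - by rewrite mulrS.
  - exact: h_neq0.
  - by split; rewrite ?mulr0n ?addr0.
  - by split; rewrite ?mulr0n ?addr0.
  - by rewrite !(height_first fanP) -PoszD.
have [jN pE] := S; move=> _.
have S' : in_sector N h j (h j *+ x + h j.+1 *+ y) x y by split.
exists (h j.+1), (h j *+ x + h j.+1 *+ y), j, 0%N, 1%N, x, y; split=> //.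
- by rewrite pE mulrS addrCA.
- exact: h_neq0.
- by split; rewrite ?mulr0n ?add0r.
- by rewrite (height_sector fanP S) (height_sector fanP S'); lia.
Qed.

Lemma floor_mnmD p q :
  (forall t, t \in slope_rays a b -> defect t p q = 0) ->
  floor_mnm (p + q) = (floor_mnm p + floor_mnm q)%MM.
Proof.
move=> flat; apply/mnmP => i; rewrite mnmDE !mnmE.
have /flat : (tnth b i, tnth a i) \in slope_rays a b by apply/mapP; exists i;
  rewrite ?mem_enum.
by rewrite /defect; lia.
Qed.

(** Above the floor a variable x_i splits off; on the floor, a generator of the
    sector together with its own floor, since floors add up on a sector. *)
Lemma adic_order_split q : Qset a b q -> (0 < adic_order q)%N ->
  exists q1 q2, [/\ Qset a b q1, Qset a b q2, q1 <> (0%N, 0%N, 0%MM),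
     q = exponent_add q1 q2 & ((adic_order q).-1 <= adic_order q2)%N].
Proof.
case: q => p t /QsetE /= pt; pose w := (t - floor_mnm p)%MM.
have tE : t = (floor_mnm p + w)%MM by rewrite /w addmC submK.
rewrite tE adic_order_on_floor; have [w0|w0] := eqVneq w 0%MM.
  rewrite w0 mdeg0 addn0 addm0 => p_gt0.
  have p_neq0 : p != 0.
    apply: contraTneq p_gt0 => ->.
    by rewrite -(mulr0n (h 0%N)) (height_first fanP).
  have [p1 [p2 [j [x1 [y1 [x2 [y2 [pE p10 S1 S2 hE]]]]]]]] :=
      sector_peel p_neq0.
  exists (p1, floor_mnm p1), (p2, floor_mnm p2); split.
  - by apply/QsetE; apply: lepm_refl.
  - by apply/QsetE; apply: lepm_refl.
  - by move=> [p1E _]; rewrite p1E eqxx in p10.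
  - rewrite /exponent_add /= pE floor_mnmD // => u uT.
    exact: defect_sector Tpos fanP _ _ _ _ _ _ _ _ uT S1 S2.
  - by rewrite hE /adic_order /=; have := height_ge0 p2; lia.
have [i wi] : exists i, w i != 0%N.
  apply/existsP; apply: contraR w0 => /existsPn w0.
  by apply/eqP/mnmP => i; rewrite mnm0E; apply/eqP; rewrite -[_ == _]negbK w0.
have wE : w = (U_(i) + (w - U_(i)))%MM by rewrite addmC submK // lep1mP.
move=> _; exists (0, U_(i)%MM), (p, floor_mnm p + (w - U_(i)))%MM; split.
- by apply/QsetE; rewrite /= floor_mnm0; apply/mnm_lepP => l; rewrite mnm0E.
- by apply/QsetE; rewrite /= lem_addr.
- by move=> q10; have := congr1 (fun q : exponent => q.2 i) q10;
    rewrite /= mnm1E eqxx mnm0E.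
- by rewrite /exponent_add /= add0r addmA [(U_(i) + _)%MM]addmC -addmA -wE.
- by rewrite adic_order_on_floor {1}wE mdegD mdeg1; lia.
Qed.

Definition first_ray_exponent (w : 'X_{1..n.+1}) : exponent :=
  let p := h 0%N *+ w ord0 in (p, floor_mnm p + mnm_tail w)%MM.

(** The successor keeps the point off the first ray of its sector, so that
    every point belongs to one sector. *)
Definition sector_exponent j (w : 'X_{1..n.+2}) : exponent :=
  let p := h j *+ w ord0 + h j.+1 *+ (mnm_tail w ord0).+1 in
  (p, floor_mnm p + mnm_tail (mnm_tail w))%MM.

(** The coordinate that is shifted in [sector_exponent] already counts once,
    hence the simplex of size [k.-1]. *)
Definition small_exponents k : seq exponent :=
  [seq first_ray_exponent w | w <- simplex n.+1 k] ++
  [seq sector_exponent j w | j <- iota 0 N, w <- simplex n.+2 k.-1].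

Lemma floor_mnm_addI p : injective (fun w => floor_mnm p + w)%MM.
Proof.
move=> w w' /(congr1 (fun t => t - floor_mnm p)%MM).
by rewrite ![(floor_mnm p + _)%MM]addmC !addmK.
Qed.

Lemma small_exponents_uniq k : uniq (small_exponents k).
Proof.
have N0 := fan_nonempty fanP.
rewrite cat_uniq; apply/and3P; split.
- rewrite map_inj_uniq ?simplex_uniq // => w w' E.
  have /= wp := congr1 fst E; have /= wt := congr1 snd E.
  have w0 : w ord0 = w' ord0.
    by have := height_first fanP (w ord0);
      rewrite wp (height_first fanP) => -[].
  by apply: mnm_cons_inj => //; move: wt; rewrite w0 => /floor_mnm_addI.
- apply/hasPn => q /allpairsP[[j w] /= [j_lt _ ->]];
    apply/mapP => -[w' _ /(congr1 fst) /= E].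
  rewrite mem_iota in j_lt.
  by apply: (@sector_not_first _ _ _ fanP j (w ord0) (mnm_tail w ord0)
      (w' ord0)); split.
- apply: allpairs_uniq; rewrite ?iota_uniq ?simplex_uniq //.
  move=> [j w] [j' w'] /allpairsP[[j1 ?] [/= j_lt _ [jE _]]].
  move=> /allpairsP[[j1' ?] [/= j'_lt _ [j'E _]]] E.
  rewrite -jE mem_iota /= in j_lt; rewrite -j'E mem_iota /= in j'_lt.
  have /= pE := congr1 fst E; have /= tE := congr1 snd E.
  have [jj' x y] := sector_unique fanP (conj j_lt erefl) (conj j'_lt pE).
  rewrite jj'; congr pair; apply: (mnm_cons_inj x); apply: (mnm_cons_inj y).
  by move: tE; rewrite pE => /floor_mnm_addI.
Qed.

Lemma mem_small_exponents k q :
  q \in small_exponents k <-> Qset a b q /\ (adic_order q < k)%N.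
Proof.
have lep_floor p w : Qset a b (p, floor_mnm p + w)%MM by apply/QsetE;
  rewrite lem_addr.
rewrite mem_cat; split=> [/orP[/mapP[w]|/allpairsP[[j w] /= []]]|[/QsetE]].
- rewrite mem_simplex mdeg_tail => w_lt ->; split; first exact: lep_floor.
  by rewrite adic_order_on_floor (height_first fanP).
- rewrite mem_iota mem_simplex !mdeg_tail => j_lt w_lt ->; split;
    first exact: lep_floor.
  rewrite adic_order_on_floor (height_sector fanP (conj j_lt erefl)) -PoszD absz_nat.
  by move: w_lt; case: k => //=; lia.
case: q => p t /= pt; pose w := (t - floor_mnm p)%MM.
have -> : t = (floor_mnm p + w)%MM by rewrite /w addmC submK.
rewrite adic_order_on_floor; have [[x pE]|[j [x [y S]]]] := sector_cover fanP p.
  rewrite pE (height_first fanP) => xw; apply/orP; left.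
  apply/mapP; exists (mnm_cons x w);
    last by rewrite /first_ray_exponent mnm_cons0 mnm_consK.
  by rewrite mem_simplex mdeg_tail mnm_cons0 mnm_consK.
rewrite (height_sector fanP S) => xyw; have [jN pE] := S; apply/orP; right.
apply/allpairsP; exists (j, mnm_cons x (mnm_cons y w)); split.
- by rewrite mem_iota.
- by rewrite mem_simplex !mdeg_tail !(mnm_cons0, mnm_consK); lia.
- by rewrite /sector_exponent /= !(mnm_cons0, mnm_consK) -pE.
Qed.

Lemma size_small_exponents k :
  size (small_exponents k) = ('C(n + k, n.+1) + N * 'C(n.+1 + k.-1, n.+2))%N.
Proof. by rewrite size_cat size_map size_allpairs size_iota !size_simplex. Qed.

End AdicOrder.

(** * Limits *)

Section Limits.
Implicit Types (u v : nat -> R) (l : R).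

Lemma Un_cvP u l : Un_cv u l <->
  forall eps, 0 < eps -> exists m, forall k, (m <= k)%N -> `|u k - l| < eps.
Proof.
split=> cv eps eps0.
  have [|m mP] := cv eps; first by apply/RltP.
  by exists m => k /ssrnat.leP /mP /RltP;
    rewrite /Rfunctions.R_dist RabsE RminusE.
have [|m mP] := cv eps; first by apply/RltP.
by exists m => k /ssrnat.leP /mP ?; apply/RltP;
  rewrite /Rfunctions.R_dist RabsE RminusE.
Qed.

Lemma Un_cv_eq u v l : u =1 v -> Un_cv u l -> Un_cv v l.
Proof. by move=> /funext ->. Qed.

Lemma Un_cv_const l : Un_cv (fun=> l) l.
Proof. by apply/Un_cvP => eps eps0; exists 0%N => k _;
  rewrite subrr normr0. Qed.

Lemma Un_cv_inv : Un_cv (fun k => k%:R^-1) 0.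
Proof.
apply/Un_cvP => eps eps0; exists (Num.bound eps^-1) => k mk.
have eps_lt : eps^-1 < k%:R.
  apply: (@lt_le_trans _ _ (Num.bound eps^-1)%:R); last by rewrite ler_nat.
  by apply: archi_boundP; rewrite invr_ge0 ltW.
have k0 : 0 < k%:R :> R by apply: lt_trans eps_lt; rewrite invr_gt0.
rewrite subr0 ger0_norm; last by rewrite invr_ge0 ltW.
by rewrite -[eps]invrK ltf_pV2 ?posrE ?invr_gt0.
Qed.

Lemma Un_cv_shift_ratio c : Un_cv (fun k => (k%:R + c) / k%:R) 1.
Proof.
have cv := CV_mult _ _ _ _ (Un_cv_const c) Un_cv_inv.
have {}cv := CV_plus _ _ _ _ (Un_cv_const 1) cv.
apply/Un_cvP => eps eps0; have /Un_cvP/(_ eps eps0)[m mP] := cv.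
exists m.+1 => k mk; have := mP k (ltnW mk).
rewrite !RplusE !RmultE mulr0 addr0 mulrDl divff //.
by rewrite pnatr_eq0 -lt0n (leq_ltn_trans _ mk).
Qed.

Lemma Un_cv_ffact c m : Un_cv (fun k => ((c + k) ^_ m)%:R / k%:R ^+ m) 1.
Proof.
elim: m => [|m IH].
  by apply: Un_cv_eq (Un_cv_const 1) => k; rewrite ffactn0 expr0 divr1.
have cv := CV_mult _ _ _ _ IH (Un_cv_shift_ratio (c%:R - m%:R)).
rewrite RmultE mulr1 in cv; apply/Un_cvP => eps eps0.
have /Un_cvP/(_ eps eps0)[k0 k0P] := cv; exists (k0 + m)%N => k k_ge.
have := k0P k (leq_trans (leq_addr _ _) k_ge); rewrite RmultE.
have mk : (m <= c + k)%N by apply: leq_trans (leq_addl c k);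
  apply: leq_trans k_ge; apply: leq_addl.
suff -> : ((c + k) ^_ m.+1)%:R / k%:R ^+ m.+1 =
  ((c + k) ^_ m)%:R / k%:R ^+ m * ((k%:R + (c%:R - m%:R)) / k%:R) :> R by [].
by rewrite ffactnSr natrM natrB // natrD exprSr invfM mulrACA;
  congr (_ * (_ * _)); ring.
Qed.

(** The first binomial coefficient has degree n + 1 in k and vanishes in the
    limit; the second one has leading coefficient 1 / (n + 2)!. *)
Lemma Un_cv_binomial_volume n N : Un_cv (fun k => (n.+2)`!%:R *
    ('C(n + k, n.+1) + N * 'C(n.+1 + k.-1, n.+2))%N%:R / k%:R ^+ n.+2) N%:R.
Proof.
have cv1 := CV_mult _ _ _ _ (CV_mult _ _ _ _ (Un_cv_const (n.+2)%:R)
    (Un_cv_ffact n n.+1)) Un_cv_inv.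
have cv2 := CV_mult _ _ _ _ (Un_cv_const N%:R) (Un_cv_ffact n n.+2).
have := CV_plus _ _ _ _ cv1 cv2; rewrite !(RplusE, RmultE) mulr0 add0r mulr1.
apply: Un_cv_eq => k; rewrite !(RplusE, RmultE).
(* At k = 0 both sides are 0, since the inverse of 0 is 0. *)
case: k => [|k]; first by rewrite !expr0n /= invr0 !mulr0 addr0.
rewrite addSnnS /= -!bin_ffact natrD mulrDr mulrDl factS !natrM.
have k0 : k.+1%:R != 0 :> R by rewrite pnatr_eq0.
have kn : k.+1%:R ^+ n.+1 != 0 :> R by rewrite expf_neq0.
have -> : k.+1%:R ^+ n.+2 = k.+1%:R * k.+1%:R ^+ n.+1 :> R by rewrite exprS.
move: k.+1%:R (k.+1%:R ^+ n.+1) k0 kn => x y x0 y0.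
by congr (_ + _); field; rewrite x0 y0.
Qed.

End Limits.

Theorem theorem2p5 (K : fieldType) (n : nat) (a b : n.-tuple nat)
    (n_gt0 : (0 < n)%N)
    (a_gt0 : forall i : 'I_n, (0 < tnth a i)%N)
    (b_gt0 : forall i : 'I_n, (0 < tnth b i)%N)
    (ab_fan : fan_ordered a b) :
  hilbert_samuel_multiplicity n.+2 (@max_ideal K n a b)
    ((hilbert_number a b)%:R - 1)%R /\
  (fan_nondegenerate a b ->
   hilbert_samuel_multiplicity n.+2 (@max_ideal K n a b)
     ((\sum_(i < n.+1) #|` fan_hilbert_basis a b i|%:R) - n%:R - 1)%R).
Proof.
have [N [h fanP]] := indexed_fan_exists (slope_rays_pos a_gt0 b_gt0).
have [J [J0 Jn J_mono J_ray]] := ray_index n_gt0 a_gt0 b_gt0 ab_fan fanP.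
have mult : hilbert_samuel_multiplicity n.+2 (@max_ideal K n a b) N%:R.
  exists (fun k => size (small_exponents a b N h k)); split=> [k|].
    apply: (@quotient_length_max_ideal_pow K n a b (adic_order a b N h) _ _ _ k).
    - by apply: (adic_order_superadditive a_gt0 b_gt0 fanP).
    - by apply: (adic_order_gt0 fanP).
    - by apply: (adic_order_split a_gt0 b_gt0 fanP).
    - exact: (small_exponents_uniq fanP k).
    - exact: (mem_small_exponents fanP k).
  by under [X in Un_cv X _]funext => k do rewrite size_small_exponents;
    exact: Un_cv_binomial_volume.
rewrite (hilbert_numberE n_gt0 a_gt0 b_gt0 ab_fan fanP J0 Jn J_mono J_ray) -natr_sum.
rewrite (sum_card_fan_hilbert_basis n_gt0 a_gt0 b_gt0 ab_fan fanP J0 Jn J_mono J_ray).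
split=> [|_]; first by rewrite -natr1 addrK.
by rewrite addnS -natr1 natrD addrAC !addrK.
Qed.
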